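(* Let $C$ be a tilted algebra, let $E=\operatorname{Ext}^2_C(DC,C)$, and let $B=C\ltimes E$ be the corresponding cluster-tilted algebra. Let $M$ be a partial tilting $C$-module. Then $M$, viewed as a $B$-module, is $\tau_B$-rigid if and only if $\operatorname{Hom}_C(\tau_C^{-1}\Omega_C^{-1}M,\operatorname{Gen}M)=0$.
   Context: All algebras are finite dimensional over an algebraically closed field $k$, and all modules are finitely generated right modules. A tilted algebra is an algebra of the form $\operatorname{End}_A T$, where $A$ is a hereditary algebra and $T$ is a tilting $A$-module. For an algebra $\Lambda$, a $\Lambda$-module $T$ is partial tilting if $\operatorname{pd}_\Lambda T\le 1$ and $\operatorname{Ext}^1_\Lambda(T,T)=0$; it is tilting if moreover there is a short exact sequence $0\to \Lambda\to T'\to T''\to 0$ with $T',T''\in\operatorname{add}T$, where $\operatorname{add} T$ is the class of direct sums of direct summands of $T$. $D=\operatorname{Hom}_k(-,k)$ is the standard duality, and $E=\operatorname{Ext}^2_C(DC,C)$ has its natural $C$-$C$-bimodule structure. $C\ltimes E$ is the trivial extension: the vector space $C\oplus E$ with multiplication $(c,e)(c',e')=(cc',ce'+ec')$. A right $C$-module $M$ is regarded as a right $B$-module by $m\cdot(c,e)=mc$. $\tau_\Lambda$ and $\tau_\Lambda^{-1}$ are the Auslander–Reiten translations in $\operatorname{mod}\Lambda$, and $\Omega_C^{-1}M$ is the first cosyzygy of $M$. A $\Lambda$-module $X$ is $\tau_\Lambda$-rigid if $\operatorname{Hom}_\Lambda(X,\tau_\Lambda X)=0$. $\operatorname{Gen}M$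 is the class of $C$-modules $X$ admitting an epimorphism $M^d\to X$ for some integer $d\ge 0$. $\operatorname{Hom}_C(Y,\operatorname{Gen}M)=0$ means $\operatorname{Hom}_C(Y,X)=0$ for all $X\in\operatorname{Gen}M$. *)

(* Defs.v *)
From HB Require Import structures.
From mathcomp Require Import all_boot all_order all_algebra all_field.

Set Implicit Arguments.
Unset Strict Implicit.
Unset Printing Implicit Defensive.

Import GRing.Theory.
Local Open Scope ring_scope.

(* Every module is a finite-dimensional right module.  Left modules over A are
   handled as right modules over the opposite algebra [opalg A].  Notions that
   are defined only up to isomorphism (Tr, the Auslander-Reiten translations,
   cosyzygies, Ext^2) are rendered as relations "N is a ... of M". *)

Section Modules.
Variables (k : fieldType) (A : falgType k).

Record rmodType := RMod {
  rcar :> vectType k;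
  ract : rcar -> A -> rcar;
  ract_linearr : forall x, linear (ract x);
  ract_linearl : forall a, linear (fun x => ract x a);
  ract1 : forall x, ract x 1 = x;
  ractM : forall x a b, ract x (a * b) = ract (ract x a) b
}.

Definition ractr (M : rmodType) (a : A) (x : M) : M := ract x a.

HB.instance Definition _ (M : rmodType) (a : A) :=
  GRing.isLinear.Build k M M *:%R (@ractr M a) (@ract_linearl M a).

HB.instance Definition _ (M : rmodType) (x : M) :=
  GRing.isLinear.Build k A M *:%R (@ract M x) (@ract_linearr M x).

End Modules.

Notation "x ** a" := (ract x a) (at level 40, left associativity) : ring_scope.

Section OppositeAlgebra.
Variables (k : fieldType) (A : falgType k).

Definition opalg : Type := A^c.
HB.instance Definition _ := Vector.copy opalg A.
HB.instance Definition _ := GRing.NzRing.copy opalg A^c.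

Fact opalg_scalerAl (a : k) (u v : opalg) :
  a *: (u * v) = (a *: u : opalg) * v.
Proof. exact: (@scalerAr k A a v u). Qed.
HB.instance Definition _ :=
  GRing.Lmodule_isLalgebra.Build k opalg opalg_scalerAl.

Fact opalg_scalerAr (a : k) (u v : opalg) :
  a *: (u * v) = u * (a *: v : opalg).
Proof. exact: (@scalerAl k A a v u). Qed.
HB.instance Definition _ :=
  GRing.Lalgebra_isAlgebra.Build k opalg opalg_scalerAr.
HB.instance Definition _ := Algebra_isFalgebra.Build k opalg.

End OppositeAlgebra.

Section Constructions.
Variables (k : fieldType) (A : falgType k).

Fact regmod_linearr (x : A) : linear (fun a : A => x * a).
Proof. by move=> c u v; rewrite mulrDr scalerAr. Qed.
Fact regmod_linearl (a : A) : linear (fun x : A => x * a).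
Proof. by move=> c u v; rewrite mulrDl scalerAl. Qed.
Definition regmod : rmodType A :=
  RMod regmod_linearr regmod_linearl (@mulr1 A) (@mulrA A).

Definition reg_lmul (a : A) : 'End(regmod) := amull a.

Section DirectSum.
Variables M N : rmodType A.
Definition dsum_act (x : (M * N)%type) (a : A) : (M * N)%type :=
  (x.1 ** a, x.2 ** a).
Fact dsum_linearr x : linear (dsum_act x).
Proof. by move=> c u v; rewrite /dsum_act !linearP. Qed.
Fact dsum_linearl a : linear (fun x => dsum_act x a).
Proof. by move=> c u v; congr pair; apply: ract_linearl. Qed.
Fact dsum_act1 x : dsum_act x 1 = x.
Proof. by case: x => x y; rewrite /dsum_act !ract1. Qed.
Fact dsum_actM x a b : dsum_act x (a * b) = dsum_act (dsum_act x a) b.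
Proof. by rewrite /dsum_act !ractM. Qed.
Definition dsum : rmodType A :=
  RMod dsum_linearr dsum_linearl dsum_act1 dsum_actM.
End DirectSum.

Section Power.
Variables (M : rmodType A) (d : nat).
Definition rpow_act (x : {ffun 'I_d -> M}) (a : A) : {ffun 'I_d -> M} :=
  [ffun i => x i ** a].
Fact rpow_linearr x : linear (rpow_act x).
Proof. by move=> c u v; apply/ffunP=> i; rewrite !ffunE linearP. Qed.
Fact rpow_linearl a : linear (fun x => rpow_act x a).
Proof. by move=> c u v; apply/ffunP=> i; rewrite !ffunE ract_linearl. Qed.
Fact rpow_act1 x : rpow_act x 1 = x.
Proof. by apply/ffunP=> i; rewrite !ffunE ract1. Qed.
Fact rpow_actM x a b : rpow_act x (a * b) = rpow_act (rpow_act x a) b.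
Proof. by apply/ffunP=> i; rewrite !ffunE ractM. Qed.
Definition rpow : rmodType A :=
  RMod rpow_linearr rpow_linearl rpow_act1 rpow_actM.
End Power.

(* The left module D M, with (a phi)(m) = phi(m a). *)
Section Dual.
Variable M : rmodType A.
Definition dual_act (phi : 'Hom(M, k^o)) (a : opalg A) : 'Hom(M, k^o) :=
  (phi \o linfun (ractr (M := M) a))%VF.
Fact dual_actE phi a m : dual_act phi a m = phi (m ** (a : A)).
Proof. by rewrite comp_lfunE lfunE. Qed.
Fact dual_linearr phi : linear (dual_act phi).
Proof.
move=> c u v; apply/lfunP=> m.
rewrite add_lfunE scale_lfunE !dual_actE -linearP; congr (phi _).
exact: (@ract_linearr k A M m c u v).
Qed.
Fact dual_linearl a : linear (fun phi => dual_act phi a).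
Proof.
by move=> c u v; apply/lfunP=> m; rewrite !(add_lfunE, scale_lfunE, dual_actE).
Qed.
Fact dual_act1 phi : dual_act phi 1 = phi.
Proof. by apply/lfunP=> m; rewrite dual_actE (ract1 m). Qed.
Fact dual_actM phi a b : dual_act phi (a * b) = dual_act (dual_act phi a) b.
Proof.
by apply/lfunP=> m; rewrite !dual_actE; congr (phi _); apply: (ractM m).
Qed.
Definition dual : rmodType (opalg A) :=
  RMod dual_linearr dual_linearl dual_act1 dual_actM.
End Dual.

(* (A^op)^op is A up to conversion. *)
Definition opopK (M : rmodType (opalg (opalg A))) : rmodType A :=
  @RMod k A (rcar M) (@ract k _ M) (@ract_linearr k _ M) (@ract_linearl k _ M)
    (@ract1 k _ M) (@ractM k _ M).

End Constructions.

(* The right module D A, with (phi a)(x) = phi(a x). *)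
Definition DA (k : fieldType) (A : falgType k) : rmodType A :=
  opopK (dual (regmod (opalg A))).

Fact DA_actE (k : fieldType) (A : falgType k) (phi : DA A) (a x : A) :
  (phi ** a : 'Hom(A, k^o)) x = (phi : 'Hom(A, k^o)) (a * x).
Proof. exact: (@dual_actE k (opalg A) (regmod (opalg A)) phi a x). Qed.

Section HomologicalNotions.
Variables (k : fieldType) (A : falgType k).
Implicit Types M N P I T X Y Z W : rmodType A.

Definition rhom X Y (f : 'Hom(X, Y)) : Prop :=
  forall x a, f (x ** a) = f x ** a.

Definition riso X Y : Prop :=
  exists f : 'Hom(X, Y), [/\ rhom f, lker f = 0%VS & limg f = fullv].

Definition short_exact X Y Z (f : 'Hom(X, Y)) (g : 'Hom(Y, Z)) : Prop :=
  [/\ rhom f /\ rhom g, lker f = 0%VS, limg f = lker g & limg g = fullv].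

Definition submod X (U : {vspace X}) : Prop :=
  forall x a, x \in U -> x ** a \in U.

Definition superfluous X (K : {vspace X}) : Prop :=
  forall U : {vspace X}, submod U -> (U + K)%VS = fullv -> U = fullv.

Definition essential X (K : {vspace X}) : Prop :=
  forall U : {vspace X}, submod U -> (U :&: K)%VS = 0%VS -> U = 0%VS.

Definition projective P : Prop :=
  forall X Y (g : 'Hom(X, Y)) (f : 'Hom(P, Y)),
    rhom g -> rhom f -> limg g = fullv ->
    exists h : 'Hom(P, X), rhom h /\ (g \o h)%VF = f.

Definition injective_mod I : Prop :=
  forall X Y (g : 'Hom(X, Y)) (f : 'Hom(X, I)),
    rhom g -> rhom f -> lker g = 0%VS ->
    exists h : 'Hom(Y, I), rhom h /\ (h \o g)%VF = f.

Definition hereditary : Prop :=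
  forall P X (i : 'Hom(X, P)),
    projective P -> rhom i -> lker i = 0%VS -> projective X.

Definition pd_le1 X : Prop :=
  exists P1 P0 (f : 'Hom(P1, P0)) (g : 'Hom(P0, X)),
    [/\ projective P1, projective P0 & short_exact f g].

Record proj_resolution X (P : nat -> rmodType A)
    (d : forall n, 'Hom(P n.+1, P n)) (eps : 'Hom(P 0%N, X)) : Prop := {
  res_proj : forall n, projective (P n);
  res_homd : forall n, rhom (d n);
  res_home : rhom eps;
  res_epi : limg eps = fullv;
  res_exact0 : limg (d 0%N) = lker eps;
  res_exact : forall n, limg (d n.+1) = lker (d n)
}.

Section Cochains.
Variables (P : nat -> rmodType A) (d : forall n, 'Hom(P n.+1, P n)).

Definition cocycle n Y (f : 'Hom(P n, Y)) : Prop :=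
  rhom f /\ (f \o d n)%VF = 0.

Definition coboundary n Y (f : 'Hom(P n.+1, Y)) : Prop :=
  exists g : 'Hom(P n, Y), rhom g /\ f = (g \o d n)%VF.

End Cochains.

Definition Ext1_eq0 X Y : Prop :=
  forall (P : nat -> rmodType A) (d : forall n, 'Hom(P n.+1, P n))
         (eps : 'Hom(P 0%N, X)),
  proj_resolution d eps ->
  forall f : 'Hom(P 1%N, Y), cocycle d f -> coboundary d f.

Definition partial_tilting T : Prop := pd_le1 T /\ Ext1_eq0 T T.

Definition summand X T : Prop := exists Y, riso T (dsum X Y).

Inductive in_add T : rmodType A -> Prop :=
| in_add0 X : \dim {:X} = 0%N -> in_add T X
| in_addS X Y Z :
    summand X T -> in_add T Y -> riso Z (dsum X Y) -> in_add T Z.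

Definition tilting T : Prop :=
  partial_tilting T /\
  exists T1 T2 (f : 'Hom(regmod A, T1)) (g : 'Hom(T1, T2)),
    [/\ in_add T T1, in_add T T2 & short_exact f g].

Definition in_Gen M X : Prop :=
  exists (d : nat) (f : 'Hom(rpow M d, X)), rhom f /\ limg f = fullv.

Record min_proj_presentation M P1 P0
    (p1 : 'Hom(P1, P0)) (p0 : 'Hom(P0, M)) : Prop := {
  mpp_proj1 : projective P1;
  mpp_proj0 : projective P0;
  mpp_hom1 : rhom p1;
  mpp_hom0 : rhom p0;
  mpp_epi : limg p0 = fullv;
  mpp_exact : limg p1 = lker p0;
  mpp_min0 : superfluous (lker p0);
  mpp_min1 : superfluous (lker p1)
}.

(* N is the left module Tr M, the cokernel of
   Hom_A(P0, A) -> Hom_A(P1, A) for a minimal projective presentation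
   P1 -> P0 -> M -> 0; q is the quotient map, and only its values on
   A-linear maps are relevant. *)
Definition is_Tr M (N : rmodType (opalg A)) : Prop :=
  exists P1 P0 (p1 : 'Hom(P1, P0)) (p0 : 'Hom(P0, M))
         (q : 'Hom('Hom(P1, regmod A), N)),
  [/\ min_proj_presentation p1 p0,
      forall y : N, exists f, rhom f /\ q f = y,
      forall f, rhom f ->
        (q f = 0 <-> exists g : 'Hom(P0, regmod A), rhom g /\ f = (g \o p1)%VF)
    & forall (a : A) f, rhom f -> q (reg_lmul a \o f)%VF = q f ** (a : opalg A)].

Definition is_cosyzygy M W : Prop :=
  exists I (u : 'Hom(M, I)) (p : 'Hom(I, W)),
    [/\ injective_mod I, short_exact u p & essential (limg u)].

End HomologicalNotions.

Section Translations.
Variables (k : fieldType) (A : falgType k).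
Implicit Types M X Y : rmodType A.

(* tau = D Tr *)
Definition is_tau M X : Prop :=
  exists N : rmodType (opalg A), is_Tr M N /\ riso X (opopK (dual N)).

(* tau^-1 = Tr D *)
Definition is_tau_inv M X : Prop :=
  exists N : rmodType (opalg (opalg A)), is_Tr (dual M) N /\ riso X (opopK N).

Definition tau_rigid X : Prop :=
  forall Y, is_tau X Y -> forall f : 'Hom(X, Y), rhom f -> f = 0.

End Translations.

(* phi identifies C with End_A T, endomorphisms acting on the left of T. *)
Definition tilted (k : fieldType) (C : falgType k) : Prop :=
  exists (A : falgType k) (T : rmodType A) (phi : 'Hom(C, 'End(T))),
  [/\ hereditary A /\ tilting T,
      lker phi = 0%VS,
      forall f : 'End(T), rhom f <-> exists c, f = phi c,
      phi 1 = \1%VF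
    & forall a b, phi (a * b) = (phi a \o phi b)%VF].

Section Bimodules.
Variables (k : fieldType) (C : falgType k).

Record bimodType := BiMod {
  bimod_rmod :> rmodType C;
  lact : C -> bimod_rmod -> bimod_rmod;
  lact_linearr : forall c, linear (lact c);
  lact_linearl : forall x, linear (fun c => lact c x);
  lact1 : forall x, lact 1 x = x;
  lactM : forall a b x, lact (a * b) x = lact a (lact b x);
  lact_ract : forall a x b, lact a x ** b = lact a (x ** b)
}.

(* The endomorphism phi |-> c phi of the right module D C, where
   (c phi)(x) = phi(x c). *)
Definition DA_lmul_fun (c : C) (phi : DA C) : DA C :=
  ((phi : 'Hom(C, k^o)) \o amulr c)%VF.
Fact DA_lmul_linear c : linear (DA_lmul_fun c).
Proof.
by move=> a u v; rewrite /DA_lmul_fun comp_lfunDl comp_lfunZl.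
Qed.
HB.instance Definition _ (c : C) :=
  GRing.isLinear.Build k (DA C) (DA C) *:%R (DA_lmul_fun c) (DA_lmul_linear c).
Definition DA_lmul (c : C) : 'End(DA C) := linfun (DA_lmul_fun c).

Fact DA_lmulE c (phi : DA C) (x : C) :
  (DA_lmul c phi : 'Hom(C, k^o)) x = (phi : 'Hom(C, k^o)) (x * c).
Proof.
have -> : DA_lmul c phi = DA_lmul_fun c phi by rewrite lfunE.
by rewrite comp_lfunE lfunE.
Qed.

(* E is Ext^2_C(DC, C): the second cohomology of Hom_C(P, C) for a projective
   resolution P of DC, q being the quotient map on cocycles.  C acts on the
   left through its left multiplication on the second argument C, and on the
   right through its left action on DC, lifted to P. *)
Definition is_Ext2_DC (E : bimodType) : Prop :=
  exists (P : nat -> rmodType C) (d : forall n, 'Hom(P n.+1, P n))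
         (eps : 'Hom(P 0%N, DA C)) (q : 'Hom('Hom(P 2%N, regmod C), E)),
  [/\ proj_resolution d eps,
      forall e : E, exists f, cocycle d f /\ q f = e,
      forall f, cocycle d f -> (q f = 0 <-> coboundary d f),
      forall (c : C) f, cocycle d f -> q (reg_lmul c \o f)%VF = lact c (q f)
    & forall (c : C) (h : forall n, 'End(P n)),
        (forall n, rhom (h n)) ->
        (forall n, (d n \o h n.+1)%VF = (h n \o d n)%VF) ->
        (eps \o h 0%N)%VF = (DA_lmul c \o eps)%VF ->
        forall f, cocycle d f -> q (f \o h 2%N)%VF = q f ** c].

End Bimodules.

Section TrivialExtension.
Variables (k : fieldType) (C : falgType k) (E : bimodType C).

HB.instance Definition _ (c : C) :=
  GRing.isLinear.Build k E E *:%R (@lact k C E c) (@lact_linearr k C E c).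

Definition trivext : Type := (C * E)%type.
HB.instance Definition _ := Vector.copy trivext (C * E)%type.

Definition trivext_one : trivext := (1, 0).
Definition trivext_mul (x y : trivext) : trivext :=
  (x.1 * y.1, lact x.1 y.2 + x.2 ** y.1).

Fact trivext_mulDl : left_distributive trivext_mul +%R.
Proof.
move=> x y z; congr pair; first exact: mulrDl.
have := lact_linearl z.2 1 x.1 y.1; rewrite !scale1r => /= ->.
have := ract_linearl z.1 1 x.2 y.2; rewrite !scale1r => /= ->.
by rewrite addrACA.
Qed.
Fact trivext_mulDr : right_distributive trivext_mul +%R.
Proof.
move=> x y z; congr pair; first exact: mulrDr.
by rewrite /= !linearD addrACA.
Qed.
Fact trivext_mulA : associative trivext_mul.
Proof.
move=> x y z; congr pair; first exact: mulrA.
have := ract_linearl z.1 1 (lact x.1 y.2) (x.2 ** y.1).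
rewrite !scale1r /= => ->.
by rewrite linearD lactM ractM lact_ract addrA.
Qed.
Fact trivext_mul1l : left_id trivext_one trivext_mul.
Proof.
move=> [c e]; congr pair; first exact: mul1r.
by rewrite /= lact1 -[0 ** c]/(ractr c 0) linear0 addr0.
Qed.
Fact trivext_mul1r : right_id trivext_one trivext_mul.
Proof.
move=> [c e]; congr pair; first exact: mulr1.
by rewrite /= linear0 ract1 add0r.
Qed.
Fact trivext_one_neq0 : trivext_one != 0.
Proof. by apply/eqP=> -[/eqP]; rewrite oner_eq0. Qed.

HB.instance Definition _ := GRing.Zmodule_isNzRing.Build trivext
  trivext_mulA trivext_mul1l trivext_mul1r trivext_mulDl trivext_mulDr
  trivext_one_neq0.

Fact trivext_scalerAl (a : k) (x y : trivext) : a *: (x * y) = (a *: x) * y.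
Proof.
congr pair; first exact: scalerAl.
have := lact_linearl y.2 a x.1 0; rewrite addr0 /= => ->.
have -> : lact 0 y.2 = 0.
  by have := lact_linearl y.2 (-1) 0 0; rewrite scaler0 addr0 scaleN1r addNr.
by rewrite addr0 -[X in _ = _ + X]/(ractr y.1 (a *: x.2)) linearZ scalerDr.
Qed.
HB.instance Definition _ :=
  GRing.Lmodule_isLalgebra.Build k trivext trivext_scalerAl.

Fact trivext_scalerAr (a : k) (x y : trivext) : a *: (x * y) = x * (a *: y).
Proof.
by congr pair; [exact: scalerAr | rewrite /= scalerDr !linearZ].
Qed.
HB.instance Definition _ :=
  GRing.Lalgebra_isAlgebra.Build k trivext trivext_scalerAr.
HB.instance Definition _ := Algebra_isFalgebra.Build k trivext.

Section Inflation.
Variable M : rmodType C.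
Definition inflate_act (x : M) (b : trivext) : M := x ** b.1.
Fact inflate_linearr x : linear (inflate_act x).
Proof. by move=> c u v; rewrite /inflate_act linearP. Qed.
Fact inflate_linearl b : linear (fun x => inflate_act x b).
Proof. by move=> c u v; apply: ract_linearl. Qed.
Fact inflate_act1 x : inflate_act x 1 = x.
Proof. exact: ract1. Qed.
Fact inflate_actM x a b :
  inflate_act x (a * b) = inflate_act (inflate_act x a) b.
Proof. exact: ractM. Qed.
Definition inflate : rmodType trivext :=
  RMod inflate_linearr inflate_linearl inflate_act1 inflate_actM.
End Inflation.

End TrivialExtension.

(* Main.v *)
Require Import Defs.
From mathcomp Require Import all_boot all_order all_algebra all_field.
From HB Require Import structures.
From Stdlib Require Import Classical ClassicalEpsilon.

(** Write [Ext(X, Z) = 0] for the vanishing of first extension groups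
    ([ext_vanish]).  The theorem is obtained by comparing both of its sides
    with the statement that every balanced map [M x E -> X], that is, every
    map [M (x)_C E -> X], is zero as soon as [X] lies in [Gen M].

    The side of the trivial extension [B] rests on the criterion of Auslander
    and Smalo that [M] is tau-rigid if and only if [Ext_B(M, Z) = 0] for all
    [Z] in [Gen M] ([tau_rigid_ext]).  A [B]-module extension of [M] by a
    [C]-module [X] consists of a [C]-module extension and a balanced map
    [M x E -> X], which records the action of [E] on lifts of elements of [M].
    As [M] has projective dimension at most 1 and no self-extensions,
    [Ext_C(M, X) = 0] for [X] in [Gen M], so only the balanced maps remain
    ([tau_rigid_balanced]).

    For the other side let [W] be the cosyzygy of [M] and let [Y] be its
    inverse translate [tau^-1 W].  If [C] has global dimension at most 2, then
    [Y] and [M (x)_C E] are both [Ext^2(D C, M)].  For [Y] this is dimension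
    shifting: the cosyzygy of [W] is injective, so that [Y] is the cokernel of
    [Hom(D C, I0) -> Hom(D C, I1)] for the injective copresentation
    [0 -> W -> I0 -> I1 -> 0], hence [Ext^1(D C, W)], and [W] is a cosyzygy of
    [M] ([tau_inv_cosyzygy_ext2]).  For [M (x)_C E] it holds because the second
    syzygy of [D C] is projective, so that [Ext^2(D C, -)] is right exact; a
    dual basis of that syzygy writes each 2-cocycle with values in [M] as a sum
    of products [m phi] with [phi] a 2-cocycle with values in [C]
    ([cocycle_dual_basis], [balanced_tau_inv]).

    A tilted algebra [C = End_A T] does have global dimension at most 2
    ([tilted_gldim_le2]).  A map [C^m -> C^n] of free modules comes from a map
    [T^m -> T^n], and its kernel is [Hom(T, S)], where [S] is the sum of the
    images of all maps from [T] to the kernel of [T^m -> T^n].  As [A] is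
    hereditary and [T] has no self-extensions, [S] is a direct summand of some
    [T^r] ([rigid_cover_split]), so the kernel is a direct summand of [C^r]. *)

Set Implicit Arguments.
Unset Strict Implicit.
Unset Printing Implicit Defensive.

Import GRing.Theory.
Local Open Scope ring_scope.

(** * Linear algebra *)

Section LinearAlgebra.
Variable k : fieldType.
Implicit Types U V W : vectType k.

Lemma lfun_exists V W (f : V -> W) :
  linear f -> exists g : 'Hom(V, W), forall x, g x = f x.
Proof.
move=> lf.
pose m := GRing.isLinear.Build k V W *:%R f lf.
pose F : {linear V -> W} := HB.pack f m.
by exists (linfun F) => x; rewrite lfunE.
Qed.

Lemma comp_lfun_ext U V V' W (f : 'Hom(V, W)) (g : 'Hom(U, V))
    (f' : 'Hom(V', W)) (g' : 'Hom(U, V')) :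
  (f \o g)%VF = (f' \o g')%VF -> forall x, f (g x) = f' (g' x).
Proof. by move=> e x; rewrite -!comp_lfunE e. Qed.

Lemma limgP V W (f : 'Hom(V, W)) y : reflect (exists x, y = f x) (y \in limg f).
Proof.
apply: (iffP memv_imgP) => [[x _ ->]|[x ->]]; first by exists x.
by exists x; rewrite ?memvf.
Qed.

Lemma limg_mem V W (f : 'Hom(V, W)) x : f x \in limg f.
Proof. by apply/limgP; exists x. Qed.

Lemma limg_fullP V W (f : 'Hom(V, W)) :
  limg f = fullv <-> forall y, exists x, y = f x.
Proof.
split=> [fT y|fS]; first by apply/limgP; rewrite fT memvf.
by apply/vspaceP=> y; rewrite memvf; apply/limgP/fS.
Qed.

Lemma lker_inj V W (f : 'Hom(V, W)) : lker f = 0%VS -> injective f.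
Proof. by move=> f0; apply/lker0P; rewrite f0. Qed.

Lemma lker0_of V W (f : 'Hom(V, W)) : injective f -> lker f = 0%VS.
Proof. by move=> /lker0P/eqP. Qed.

(** Choosing values on a basis only, so that no choice function on [V] is
    needed: linear maps can be defined by a linear relation. *)
Lemma lin_choice V W (U : {vspace V}) (R : V -> W -> Prop) :
    (forall v, v \in U -> exists w, R v w) ->
    (forall a v w v' w', R v w -> R v' w' -> R (a *: v + v') (a *: w + w')) ->
  exists f : 'Hom(V, W), forall v, v \in U -> R v (f v).
Proof.
move=> Rtot Rlin.
have R00 : R 0 0.
  have [w Rw] := Rtot 0 (mem0v U).
  have := Rlin (-1) _ _ _ _ Rw Rw.
  by rewrite scaleN1r oppr0 addr0 scaleN1r addNr.
pose b := vbasis U.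
have [c Rc] : exists c : 'I_(\dim U) -> W, forall i : 'I_(\dim U), R b`_i (c i).
  apply: (@fin_all_exists _ (fun=> W)
    (fun (i : 'I_(\dim U)) x => R b`_i x)) => i.
  by apply/Rtot/vbasis_mem/mem_nth; rewrite size_tuple.
have [|f fE] := @lfun_exists V W
  (fun v => \sum_(i < \dim U) coord b i v *: c i).
  move=> a x y; rewrite scaler_sumr -big_split; apply: eq_bigr => i _ /=.
  by rewrite linearP scalerDl scalerA.
exists f => v /coord_vbasis vE; rewrite fE {1}vE.
have Rsum (x : 'I_(\dim U) -> V) (y : 'I_(\dim U) -> W) (t : 'I_(\dim U) -> k) :
    (forall i, R (x i) (y i)) -> R (\sum_i t i *: x i) (\sum_i t i *: y i).
  by move=> Rxy; elim/big_ind2: _ => // [v1 w1 v2 w2 R1 R2|i _];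
    [have := Rlin 1 _ _ _ _ R1 R2; rewrite !scale1r
    |have := Rlin (t i) _ _ _ _ (Rxy i) R00; rewrite !addr0].
exact: Rsum.
Qed.

Lemma lfun_section V W (f : 'Hom(V, W)) (U : {vspace V}) :
    (forall w, exists2 v, v \in U & f v = w) ->
  exists s : 'Hom(W, V), forall w, s w \in U /\ f (s w) = w.
Proof.
move=> fU.
have [w _|a v w v' w' [wU <-] [w'U <-]|s sP] :=
  @lin_choice W V fullv (fun w v => v \in U /\ f v = w).
- by have [v] := fU w; exists v.
- by rewrite linearP rpredD ?rpredZ.
by exists s => w; apply/sP/memvf.
Qed.

Lemma functional_sep V (U : {vspace V}) v :
  v \notin U -> exists2 l : 'Hom(V, k^o),
    forall u, u \in U -> l u = 0 & l v != 0.
Proof.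
move=> vU.
pose w := v - projv U v.
have w0 : w != 0.
  by apply: contra vU; rewrite subr_eq0 => /eqP ->; apply: memv_proj.
have [i wi] : exists i, coord (vbasis fullv) i w != 0.
  apply/existsP; apply: contraNT w0 => /existsPn c0.
  rewrite (coord_vbasis (memvf w)) big1 // => i _.
  by have /negPn/eqP -> := c0 i; rewrite scale0r.
have [|l lE] := @lfun_exists V k^o
    (fun x => coord (vbasis fullv) i (x - projv U x)).
  move=> a x y; rewrite -linearP scalerBr addrACA -opprD.
  by rewrite [projv U (a *: x + y)]linearP.
by exists l => [u uU|]; rewrite lE // projv_id // subrr linear0.
Qed.
End LinearAlgebra.

(** * Homomorphisms, free modules and projective modules *)

Section Modules.
Variables (k : fieldType) (A : falgType k).
Implicit Types X Y Z P I S Q : rmodType A.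

Lemma ractDl X (x y : X) a : (x + y) ** a = x ** a + y ** a.
Proof. exact: (linearD (ractr (M := X) a)). Qed.
Lemma ractZl X t (x : X) a : (t *: x) ** a = t *: (x ** a).
Proof. exact: (linearZ_LR (ractr (M := X) a)). Qed.
Lemma ract0l X a : (0 : X) ** a = 0.
Proof. exact: (linear0 (ractr (M := X) a)). Qed.
Lemma ractNl X (x : X) a : (- x) ** a = - (x ** a).
Proof. exact: (linearN (ractr (M := X) a)). Qed.
Lemma ractBl X (x y : X) a : (x - y) ** a = x ** a - y ** a.
Proof. by rewrite ractDl ractNl. Qed.
Lemma ract_suml X n (x : 'I_n -> X) a :
  (\sum_i x i) ** a = \sum_i x i ** a.
Proof. exact: (linear_sum (ractr (M := X) a)). Qed.

Lemma rhom0 X Y : rhom (0 : 'Hom(X, Y)).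
Proof. by move=> x a; rewrite !lfunE /= ract0l. Qed.
Lemma rhom_id X : rhom (\1%VF : 'End(X)).
Proof. by move=> x a; rewrite !lfunE. Qed.
Lemma rhom_comp X Y Z (g : 'Hom(Y, Z)) (f : 'Hom(X, Y)) :
  rhom g -> rhom f -> rhom (g \o f)%VF.
Proof. by move=> hg hf x a; rewrite !comp_lfunE hf hg. Qed.
Lemma rhomD X Y (f g : 'Hom(X, Y)) : rhom f -> rhom g -> rhom (f + g).
Proof. by move=> hf hg x a; rewrite !lfunE /= hf hg ractDl. Qed.
Lemma rhomN X Y (f : 'Hom(X, Y)) : rhom f -> rhom (- f).
Proof. by move=> hf x a; rewrite !lfunE /= hf ractNl. Qed.
Lemma rhomB X Y (f g : 'Hom(X, Y)) : rhom f -> rhom g -> rhom (f - g).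
Proof. by move=> hf hg; apply/rhomD/rhomN. Qed.
Lemma rhomZ X Y t (f : 'Hom(X, Y)) : rhom f -> rhom (t *: f).
Proof. by move=> hf x a; rewrite !lfunE /= hf ractZl. Qed.
Lemma rhom_sum X Y n (f : 'I_n -> 'Hom(X, Y)) :
  (forall i, rhom (f i)) -> rhom (\sum_i f i).
Proof. by move=> hf; elim/big_ind: _ => //; [apply: rhom0|apply: rhomD]. Qed.

Lemma submod_lker X Y (f : 'Hom(X, Y)) : rhom f -> submod (lker f).
Proof. by move=> hf x a; rewrite !memv_ker hf => /eqP ->; rewrite ract0l. Qed.
Lemma submod_limg X Y (f : 'Hom(X, Y)) : rhom f -> submod (limg f).
Proof.
by move=> hf _ a /limgP[x ->]; rewrite -hf; apply/limg_mem.
Qed.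

(** Submodules and quotient modules only enter through the inclusion and the
    projection, so they are recorded as existence statements. *)
Lemma sub_exists X (U : {vspace X}) : submod U ->
  exists S (i : 'Hom(S, X)), [/\ rhom i, lker i = 0%VS & limg i = U].
Proof.
move=> sU.
pose act (x : subvs_of U) a : subvs_of U := vsproj U (vsval x ** a).
have actE x a : vsval (act x a) = vsval x ** a.
  by rewrite vsprojK // sU ?subvsP.
have l1 x : linear (act x).
  by move=> c u v; apply: val_inj; rewrite /= actE !linearP /= !actE.
have l2 a : linear (fun x => act x a).
  move=> c u v; apply: val_inj; rewrite /= actE !linearP /= !actE.
  by rewrite ractDl ractZl.
have a1 x : act x 1 = x by apply: val_inj; rewrite /= actE ract1.
have a2 x a b : act x (a * b) = act (act x a) b.
  by apply: val_inj; rewrite /= !actE ractM.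
exists (RMod l1 l2 a1 a2), (linfun vsval); split.
- by move=> x a; rewrite !lfunE /= actE.
- by apply: lker0_of => x y; rewrite !lfunE; apply: val_inj.
apply/vspaceP=> x; apply/limgP/idP => [[y ->]|xU].
  by rewrite lfunE subvsP.
by exists (vsproj U x); rewrite lfunE /= vsprojK.
Qed.

Lemma quot_exists X (U : {vspace X}) : submod U ->
  exists Q (p : 'Hom(X, Q)), [/\ rhom p, limg p = fullv & lker p = U].
Proof.
move=> sU.
have UC0 : (U :&: U^C)%VS = 0%VS by apply: capv_compl.
have CU0 : (U^C :&: U)%VS = 0%VS by rewrite capvC.
pose pi := linfun (vsproj (U^C)%VS \o daddv_pi U^C U)%FUN.
have pE x : vsval (pi x) = daddv_pi U^C U x.
  by rewrite lfunE /= vsprojK // memv_pi.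
have piK (y : subvs_of U^C) : pi (vsval y) = y.
  by apply: val_inj; rewrite /= pE daddv_pi_id ?subvsP.
have kerp x : (pi x == 0) = (x \in U).
  have := daddv_pi_add UC0 (_ : x \in (U + U^C)%VS).
  rewrite addv_complf memvf => /(_ isT) xE.
  apply/eqP/idP => [p0|xU].
    by rewrite -xE -pE p0 linear0 addr0 memv_pi.
  apply: val_inj; rewrite /= pE; move: xE; rewrite daddv_pi_id //.
  by move/eqP; rewrite eq_sym -subr_eq0 opprD addNKr oppr_eq0 => /eqP.
pose act (x : subvs_of U^C) a : subvs_of U^C := pi (vsval x ** a).
have actE x a : act (pi x) a = pi (x ** a).
  apply/eqP; rewrite -subr_eq0 -linearB kerp -ractBl sU // -kerp linearB.
  by rewrite /= piK subrr.
have l1 x : linear (act x).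
  by move=> c u v; rewrite /act !linearP.
have l2 a : linear (fun x => act x a).
  by move=> c u v; rewrite /act linearP ractDl ractZl linearP.
have a1 x : act x 1 = x by rewrite /act ract1 piK.
have a2 x a b : act x (a * b) = act (act x a) b.
  by rewrite {3}/act actE /act ractM.
exists (RMod l1 l2 a1 a2), pi; split.
- by move=> x a; rewrite /= actE.
- by apply/limg_fullP => y; exists (vsval y); rewrite piK.
by apply/vspaceP=> x; rewrite memv_ker kerp.
Qed.

Lemma factor_epi X Q Z (p : 'Hom(X, Q)) (f : 'Hom(X, Z)) :
    rhom p -> rhom f -> limg p = fullv -> (lker p <= lker f)%VS ->
  exists g : 'Hom(Q, Z), rhom g /\ (g \o p)%VF = f.
Proof.
move=> hp hf pT kpf.
have pK y : p (p^-1%VF y) = y by rewrite limg_lfunVK // pT memvf.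
have fK x : f (p^-1%VF (p x)) = f x.
  apply/eqP; rewrite -subr_eq0 -linearB -memv_ker (subvP kpf) //.
  by rewrite memv_ker linearB /= pK subrr.
exists (f \o p^-1)%VF; split; last by apply/lfunP=> x; rewrite !comp_lfunE fK.
move=> y a; rewrite !comp_lfunE -{1}[y]pK -hp fK.
by rewrite hf.
Qed.

Lemma factor_mono X S Z (i : 'Hom(S, X)) (f : 'Hom(Z, X)) :
    rhom i -> rhom f -> lker i = 0%VS -> (limg f <= limg i)%VS ->
  exists g : 'Hom(Z, S), rhom g /\ (i \o g)%VF = f.
Proof.
move=> hi hf i0 fi.
have iK z : i (i^-1%VF (f z)) = f z.
  by rewrite limg_lfunVK // (subvP fi) ?limg_mem.
exists (i^-1 \o f)%VF; split; last by apply/lfunP=> x; rewrite !comp_lfunE iK.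
by move=> z a; apply: (lker_inj i0); rewrite hi !comp_lfunE !iK hf.
Qed.

Lemma image_factor X Y (f : 'Hom(X, Y)) : rhom f ->
  exists S (i : 'Hom(S, Y)) (r : 'Hom(X, S)),
    [/\ rhom i, rhom r, lker i = 0%VS, limg r = fullv & (i \o r)%VF = f] /\
    limg i = limg f.
Proof.
move=> hf; have [S [i [hi i0 iE]]] := sub_exists (submod_limg hf).
have [|r [hr rE]] := factor_mono hi hf i0; first by rewrite iE.
exists S, i, r; do !split=> //; apply/limg_fullP => s.
have /limgP[x sE] : i s \in limg f by rewrite -iE limg_mem.
by exists x; apply: (lker_inj i0); rewrite sE -rE comp_lfunE.
Qed.

Lemma pullback_mono X Y P (g : 'Hom(X, Y)) (f : 'Hom(P, Y)) :
    rhom g -> rhom f -> lker g = 0%VS ->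
  exists Q (j : 'Hom(Q, P)) (f' : 'Hom(Q, X)),
    [/\ rhom j, rhom f', lker j = 0%VS, (g \o f')%VF = (f \o j)%VF &
        forall p, f p \in limg g -> p \in limg j].
Proof.
move=> hg hf g0; have [V [v [hv _ vE]]] := quot_exists (submod_limg hg).
have [Q [j [hj j0 jE]]] := sub_exists (submod_lker (rhom_comp hv hf)).
have [|f' [hf' f'E]] := factor_mono hg (rhom_comp hf hj) g0.
  apply/subvP => _ /limgP[x ->]; rewrite -vE memv_ker -!comp_lfunE comp_lfunA.
  by rewrite comp_lfunE -memv_ker -jE limg_mem.
exists Q, j, f'; split=> // p; rewrite -vE jE !memv_ker comp_lfunE.
exact.
Qed.

Lemma iso_inv X Y (f : 'Hom(X, Y)) :
    rhom f -> lker f = 0%VS -> limg f = fullv ->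
  exists g : 'Hom(Y, X), [/\ rhom g, (f \o g)%VF = \1%VF & (g \o f)%VF = \1%VF].
Proof.
move=> hf f0 fT.
have [g [hg fg]] : exists g : 'Hom(Y, X), rhom g /\ (f \o g)%VF = \1%VF.
  by apply: factor_mono => //; [apply: rhom_id|rewrite fT subvf].
exists g; split => //; apply/lfunP=> x; apply: (lker_inj f0).
by rewrite -comp_lfunE comp_lfunA fg comp_lfun1l id_lfunE.
Qed.

Lemma proj_lift P X Y (g : 'Hom(X, Y)) (f : 'Hom(P, Y)) :
    projective P -> rhom g -> rhom f -> (limg f <= limg g)%VS ->
  exists h : 'Hom(P, X), rhom h /\ (g \o h)%VF = f.
Proof.
move=> pP hg hf fg.
have [S [i [g' [[hi hg' i0 gT gE] iE]]]] := image_factor hg.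
have [|f' [hf' fE]] := factor_mono hi hf i0; first by rewrite iE.
have [h [hh hE]] := pP _ _ g' f' hg' hf' gT.
by exists h; split => //; rewrite -gE -comp_lfunA hE.
Qed.

Lemma inj_ext I X Y (g : 'Hom(X, Y)) (f : 'Hom(X, I)) :
    injective_mod I -> rhom g -> rhom f -> (lker g <= lker f)%VS ->
  exists h : 'Hom(Y, I), rhom h /\ (h \o g)%VF = f.
Proof.
move=> iI hg hf gf.
have [S [i [g' [[hi hg' i0 gT gE] _]]]] := image_factor hg.
have [|f' [hf' fE]] := factor_epi hg' hf gT.
  apply: subv_trans gf; apply/subvP => x; rewrite !memv_ker -gE comp_lfunE.
  by move/eqP->; rewrite linear0.
have [h [hh hE]] := iI _ _ i f' hi hf' i0.
by exists h; split => //; rewrite -gE comp_lfunA hE.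
Qed.

Lemma proj_retract P X (i : 'Hom(X, P)) (r : 'Hom(P, X)) :
  projective P -> rhom i -> rhom r -> (r \o i)%VF = \1%VF -> projective X.
Proof.
move=> pP hi hr ri Y Z g f hg hf gT.
have [h [hh hE]] := pP _ _ _ _ hg (rhom_comp hf hr) gT.
exists (h \o i)%VF; split; first exact: rhom_comp.
by rewrite comp_lfunA hE -comp_lfunA ri comp_lfun1r.
Qed.

Lemma inj_retract I X (i : 'Hom(X, I)) (r : 'Hom(I, X)) :
  injective_mod I -> rhom i -> rhom r -> (r \o i)%VF = \1%VF ->
  injective_mod X.
Proof.
move=> iI hi hr ri Y Z g f hg hf g0.
have [h [hh hE]] := iI _ _ _ _ hg (rhom_comp hi hf) g0.
exists (r \o h)%VF; split; first exact: rhom_comp.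
by rewrite -comp_lfunA hE comp_lfunA ri comp_lfun1l.
Qed.

Definition dual_basis P n (u : 'I_n -> P) (chi : 'I_n -> 'Hom(P, regmod A)) :=
  (forall i, rhom (chi i)) /\ forall p, p = \sum_i u i ** (chi i p : A).

Lemma ract_hom X (x : X) : exists f : 'Hom(regmod A, X),
  rhom f /\ forall a : A, f a = x ** a.
Proof.
have [f fE] := lfun_exists (@ract_linearr k A X x).
by exists f; split => // a b; rewrite !fE -ractM.
Qed.

Lemma scal_hom X P (x : X) (chi : 'Hom(P, regmod A)) : rhom chi ->
  exists f : 'Hom(P, X), rhom f /\ forall p, f p = x ** (chi p : A).
Proof.
move=> hchi; have [f [hf fE]] := ract_hom x.
exists (f \o chi)%VF; split; first exact: rhom_comp.
by move=> p; rewrite comp_lfunE fE.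
Qed.

Lemma proj_of_dual_basis P n (u : 'I_n -> P) chi :
  dual_basis u chi -> projective P.
Proof.
move=> [hchi uE] X Y g f hg hf /limg_fullP gS.
have [x xE] : exists x : 'I_n -> X, forall i, f (u i) = g (x i).
  exact: (@fin_all_exists _ (fun=> X) (fun i x => f (u i) = g x)).
have [h hE] : exists h : 'I_n -> 'Hom(P, X),
    forall i, rhom (h i) /\ forall p, h i p = x i ** (chi i p : A).
  apply: (@fin_all_exists _ (fun=> 'Hom(P, X))
    (fun i h => rhom h /\ forall p, h p = x i ** (chi i p : A))) => i.
  exact: scal_hom.
exists (\sum_i h i); split; first by apply: rhom_sum => i; case: (hE i).
apply/lfunP=> p; rewrite comp_lfunE {2}[p]uE sum_lfunE !linear_sum.
by apply: eq_bigr => i _; rewrite /= (hE i).2 hf hg xE.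
Qed.

Definition freemod n := rpow (regmod A) n.

Lemma rpow_proj X n (i : 'I_n) : exists f : 'Hom(rpow X n, X),
  rhom f /\ forall v : {ffun 'I_n -> X}, f v = v i.
Proof.
have [|f fE] := @lfun_exists k (rpow X n) X (fun v : {ffun 'I_n -> X} => v i).
  by move=> a u v; rewrite !ffunE.
by exists f; split => // v a; rewrite !fE ffunE.
Qed.

Lemma rpow_univ X Y n (f : 'I_n -> 'Hom(Y, X)) : (forall i, rhom (f i)) ->
  exists g : 'Hom(Y, rpow X n),
    rhom g /\ forall y i, (g y : {ffun 'I_n -> X}) i = f i y.
Proof.
move=> hf.
have [|g gE] := @lfun_exists k Y (rpow X n) (fun y => [ffun i => f i y]).
  by move=> a u v; apply/ffunP => i; rewrite !ffunE linearP.
exists g; split=> [y a|y i]; last by rewrite gE ffunE.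
by apply/ffunP => i; rewrite !gE !ffunE hf.
Qed.

Lemma rpow_couniv X Y n (f : 'I_n -> 'Hom(X, Y)) : (forall i, rhom (f i)) ->
  exists g : 'Hom(rpow X n, Y),
    rhom g /\ forall v : {ffun 'I_n -> X}, g v = \sum_i f i (v i).
Proof.
move=> hf.
have [|g gE] := @lfun_exists k (rpow X n) Y
    (fun v : {ffun 'I_n -> X} => \sum_i f i (v i)).
  move=> a u v; rewrite scaler_sumr -big_split; apply: eq_bigr => i _ /=.
  by rewrite !ffunE linearP.
exists g; split=> // v a; rewrite !gE ract_suml; apply: eq_bigr => i _.
by rewrite ffunE hf.
Qed.

Definition fbase n (i : 'I_n) : freemod n := [ffun j => ((j == i)%:R : A)].

Lemma freemod_sum n (v : {ffun 'I_n -> A}) :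
  (v : freemod n) = \sum_i fbase i ** v i.
Proof.
apply/ffunP => j; rewrite sum_ffunE (bigD1 j) //= big1 => [|i ij].
  by rewrite !ffunE eqxx addr0 /= mul1r.
by rewrite !ffunE eq_sym (negPf ij) /= mul0r.
Qed.

Lemma freemod_projective n : projective (freemod n).
Proof.
have [chi chiE] : exists chi : 'I_n -> 'Hom(freemod n, regmod A), forall i,
    rhom (chi i) /\ forall v : {ffun 'I_n -> A}, chi i v = v i.
  apply: (@fin_all_exists _ (fun=> 'Hom(freemod n, regmod A)) (fun i c =>
     rhom c /\ forall v : {ffun 'I_n -> A}, c v = v i)) => i.
  exact: rpow_proj.
apply: (@proj_of_dual_basis _ n (@fbase n) chi); split.
  by move=> i; case: (chiE i).
move=> v; rewrite [LHS]freemod_sum; apply: eq_bigr => i _.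
by rewrite (chiE i).2.
Qed.

Lemma freemod_hom X n (x : 'I_n -> X) : exists f : 'Hom(freemod n, X),
  rhom f /\ forall v : {ffun 'I_n -> A}, f v = \sum_i x i ** v i.
Proof.
have [h hE] : exists h : 'I_n -> 'Hom(regmod A, X),
    forall i, rhom (h i) /\ forall a : A, h i a = x i ** a.
  apply: (@fin_all_exists _ (fun=> 'Hom(regmod A, X))
    (fun i h => rhom h /\ forall a : A, h a = x i ** a)) => i.
  exact: ract_hom.
have [f [hf fE]] := rpow_couniv (fun i => (hE i).1).
exists f; split=> // v; rewrite fE; apply: eq_bigr => i _.
by rewrite (hE i).2.
Qed.

Lemma freemod_cover X :
  exists n (f : 'Hom(freemod n, X)), rhom f /\ limg f = fullv.
Proof.
pose b := vbasis {: X}.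
have [f [hf fE]] := freemod_hom (fun i : 'I_(\dim {:X}) => b`_i).
exists (\dim {:X}), f; split=> //; apply/limg_fullP => x.
exists ([ffun i => coord b i x *: 1] : {ffun 'I_(\dim {:X}) -> A}).
rewrite fE [LHS](coord_vbasis (memvf x)); apply: eq_bigr => i _.
by rewrite ffunE linearZ_LR /= ract1.
Qed.

Lemma proj_dual_basis P : projective P ->
  exists n (u : 'I_n -> P) chi, dual_basis u chi.
Proof.
move=> pP; have [n [f [hf fT]]] := freemod_cover P.
have [s [hs fs]] := pP _ _ f \1%VF hf (@rhom_id P) fT.
have [c cE] : exists c : 'I_n -> 'Hom(freemod n, regmod A), forall i,
    rhom (c i) /\ forall v : {ffun 'I_n -> A}, c i v = v i.
  apply: (@fin_all_exists _ (fun=> 'Hom(freemod n, regmod A)) (fun i c =>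
     rhom c /\ forall v : {ffun 'I_n -> A}, c v = v i)) => i.
  exact: rpow_proj.
exists n, (fun i => f (fbase i)), (fun i => (c i \o s)%VF); split.
  by move=> i; apply: rhom_comp => //; case: (cE i).
move=> p; rewrite -{1}[p]id_lfunE -fs comp_lfunE {1}[s p]freemod_sum linear_sum.
by apply: eq_bigr => i _; rewrite /= comp_lfunE (cE i).2 hf.
Qed.

End Modules.

(** * Projective covers *)

Lemma ex_min (P : nat -> Prop) :
  (exists n, P n) -> exists n, P n /\ forall m, P m -> (n <= m)%N.
Proof.
move=> [n Pn]; elim/ltn_ind: n Pn => n IHn Pn.
case: (classic (exists2 m, P m & (m < n)%N)) => [[m Pm mn]|nP].
  exact: IHn Pm.
exists n; split=> // m Pm; rewrite leqNgt; apply/negP => mn.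
by case: nP; exists m.
Qed.

Section Subspaces.
Variable k : fieldType.
Implicit Types V W : vectType k.

Lemma subspace_exists V (P : V -> Prop) :
    P 0 -> (forall a u v, P u -> P v -> P (a *: u + v)) ->
  exists U : {vspace V}, forall v, v \in U <-> P v.
Proof.
move=> P0 Plin.
pose d (U : {vspace V}) := (\dim {:V} - \dim U)%N.
have [|n [[U [UP dU]] nmin]] := @ex_min (fun n =>
    exists U : {vspace V}, (forall v, v \in U -> P v) /\ d U = n).
  by exists (d 0%VS), 0%VS; split=> // v; rewrite memv0 => /eqP ->.
exists U => v; split=> [/UP//|Pv]; apply/negPn/negP => vU.
have : (d U <= d (U + <[v]>)%VS)%N.
  rewrite dU; apply: nmin; exists (U + <[v]>)%VS; split=> // w.
  case/memv_addP=> u /UP Pu [_ /vlineP[a ->] ->].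
  by rewrite addrC; apply: Plin.
rewrite /d leq_sub2lE; last by rewrite dimvS ?subvf.
move=> dUv.
have /eqP UE : U == (U + <[v]>)%VS by rewrite eqEdim addvSl.
by have := addvSr U <[v]>%VS; rewrite -UE -memvE (negPf vU).
Qed.

Lemma endo_onto_inj V (f : 'End(V)) : limg f = fullv -> lker f = 0%VS.
Proof.
move=> fT; apply/eqP; rewrite -dimv_eq0 -(capfv (lker f)).
have := limg_ker_dim f fullv; rewrite fT => /eqP.
by rewrite -[X in _ == X]add0n eqn_add2r.
Qed.

Lemma dim_limg_inj V W (f : 'Hom(V, W)) :
  lker f = 0%VS -> \dim (limg f) = \dim {:V}.
Proof. by move=> f0; rewrite limg_dim_eq // f0 capv0. Qed.

End Subspaces.

Section Covers.
Variables (k : fieldType) (A : falgType k).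
Implicit Types X Y Z P I S Q : rmodType A.

(** An endomorphism whose square has the same rank restricts to a bijection of
    its image, which is therefore a direct summand. *)
Lemma stable_image_retract X (h : 'End(X)) :
    rhom h -> (\dim (limg h) <= \dim (limg (h \o h)%VF))%N ->
  exists S (i : 'Hom(S, X)) (p r : 'Hom(X, S)),
    [/\ rhom i /\ rhom p, rhom r, (i \o p)%VF = h, (r \o i)%VF = \1%VF &
        \dim {:S} = \dim (limg h)].
Proof.
move=> hh dh.
have hhE : limg (h \o h)%VF = limg h.
  apply/eqP; rewrite eqEdim dh andbT.
  by apply/subvP => _ /limgP[x ->]; rewrite comp_lfunE limg_mem.
have [S [i [p [[hi hp i0 _ pE] iE]]]] := image_factor hh.
have piT : limg (p \o i)%VF = fullv.
  apply/limg_fullP => s.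
  have : i s \in limg (h \o h)%VF by rewrite hhE -iE limg_mem.
  case/limgP=> x; rewrite comp_lfunE -pE !comp_lfunE => sE.
  by exists (p x); apply: (lker_inj i0); rewrite sE !comp_lfunE.
have [g [hg _ gE]] := iso_inv (rhom_comp hp hi) (endo_onto_inj piT) piT.
exists S, i, p, (g \o p)%VF; split=> //; first exact: rhom_comp.
  by rewrite -comp_lfunA.
by rewrite -iE dim_limg_inj.
Qed.

(** A surjection from a projective of least dimension is a projective cover.
    If a submodule [U] also maps onto [X], lifting gives endomorphisms of the
    projective over [X] with image inside [U]; one of least rank has a stable
    image, which is a direct summand mapping onto [X], hence everything. *)
Lemma proj_cover_exists X : exists P (p : 'Hom(P, X)),
  [/\ projective P, rhom p, limg p = fullv & superfluous (lker p)].
Proof.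
pose good P (p : 'Hom(P, X)) := [/\ projective P, rhom p & limg p = fullv].
have [|n [[P [p [[pP hp pT] dP]]] nmin]] := @ex_min (fun n =>
    exists P (p : 'Hom(P, X)), good P p /\ \dim {:P} = n).
  have [m [f [hf fT]]] := freemod_cover X.
  exists (\dim {:freemod A m}), (freemod A m), f; do !split=> //.
  exact: freemod_projective.
exists P, p; split=> // U sU UK.
pose over (h : 'End(P)) :=
  [/\ rhom h, (p \o h)%VF = p & (limg h <= U)%VS].
have [|m [[h [[hh ph hU] dh]] hmin]] := @ex_min (fun m =>
    exists h, over h /\ \dim (limg h) = m).
  have [S [i [hi i0 iE]]] := sub_exists sU.
  have piT : limg (p \o i)%VF = fullv.
    apply/limg_fullP => x; have /limgP[y ->] : x \in limg p by rewrite pT memvf.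
    have : y \in (U + lker p)%VS by rewrite UK memvf.
    case/memv_addP=> u uU [z zK ->]; move: uU; rewrite -iE => /limgP[s ->].
    exists s; rewrite comp_lfunE linearD /=.
    by move: zK; rewrite memv_ker => /eqP ->; rewrite addr0.
  have [h [hh hE]] := pP _ _ _ _ (rhom_comp hp hi) hp piT.
  exists (\dim (limg (i \o h)%VF)), (i \o h)%VF; split=> //; split.
  - exact: rhom_comp.
  - by rewrite comp_lfunA.
  - by apply/subvP => _ /limgP[x ->]; rewrite -iE comp_lfunE limg_mem.
have [||S [i [s [r [[hi hs] hr isE ri dS]]]]] := @stable_image_retract P h.
- done.
- rewrite dh; apply: hmin; exists (h \o h)%VF; split=> //; split.
  + exact: rhom_comp.
  + by rewrite comp_lfunA !ph.
  + apply: subv_trans hU; apply/subvP => _ /limgP[x ->].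
    by rewrite comp_lfunE limg_mem.
apply/eqP; rewrite eqEdim subvf /=.
apply: leq_trans (dimvS hU); rewrite -dS dP; apply: nmin.
exists S, (p \o i)%VF; split=> //; split.
- exact: proj_retract ri.
- exact: rhom_comp.
apply/limg_fullP => x; have /limgP[y ->] : x \in limg p by rewrite pT memvf.
by exists (s y); rewrite -comp_lfunE -comp_lfunA isE ph.
Qed.

Lemma min_presentation_exists X : exists P1 P0 (p1 : 'Hom(P1, P0))
  (p0 : 'Hom(P0, X)), min_proj_presentation p1 p0.
Proof.
have [P0 [p0 [pP0 hp0 p0T sK0]]] := proj_cover_exists X.
have [S [i [hi i0 iE]]] := sub_exists (submod_lker hp0).
have [P1 [p [pP1 hp pT sK1]]] := proj_cover_exists S.
exists P1, P0, (i \o p)%VF, p0; split=> //; first exact: rhom_comp.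
  rewrite -iE; apply/vspaceP => x; apply/limgP/limgP => [] [y ->].
    by exists (p y); rewrite comp_lfunE.
  have /limgP[z ->] : y \in limg p by rewrite pT memvf.
  by exists z; rewrite comp_lfunE.
suff -> : lker (i \o p)%VF = lker p by [].
apply/vspaceP => x; rewrite !memv_ker comp_lfunE.
by rewrite -memv_ker i0 memv0.
Qed.

End Covers.

(** * Duality, injective envelopes and the transpose *)

Section Duality.
Variable k : fieldType.
Implicit Types V W : vectType k.

Definition tr_fun V W (f : 'Hom(V, W)) (phi : 'Hom(W, k^o)) : 'Hom(V, k^o) :=
  (phi \o f)%VF.
Fact tr_fun_linear V W (f : 'Hom(V, W)) : linear (tr_fun f).
Proof. by move=> a u v; rewrite /tr_fun comp_lfunDl comp_lfunZl. Qed.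
HB.instance Definition _ V W (f : 'Hom(V, W)) :=
  GRing.isLinear.Build k 'Hom(W, k^o) 'Hom(V, k^o) *:%R (tr_fun f)
    (tr_fun_linear f).
Definition tr V W (f : 'Hom(V, W)) : 'Hom('Hom(W, k^o), 'Hom(V, k^o)) :=
  linfun (tr_fun f).

Lemma trE V W (f : 'Hom(V, W)) phi : tr f phi = (phi \o f)%VF.
Proof. by rewrite lfunE. Qed.

(** A constant of its own, so that evaluation is recognised whichever module
    structure the space of functionals carries. *)
Definition dev V (phi : 'Hom(V, k^o)) (v : V) : k^o := phi v.

Lemma dev_ext V (phi psi : 'Hom(V, k^o)) :
  (forall v, dev phi v = dev psi v) -> phi = psi.
Proof. by move=> e; apply/lfunP. Qed.

Lemma dev_tr V W (f : 'Hom(V, W)) phi v : dev (tr f phi) v = dev phi (f v).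
Proof. by rewrite /dev trE comp_lfunE. Qed.

Lemma dev0l V (v : V) : dev 0 v = 0.
Proof. by rewrite /dev lfunE. Qed.

Lemma dev0r V (phi : 'Hom(V, k^o)) : dev phi 0 = 0.
Proof. exact: linear0. Qed.

Lemma devPl V a (phi psi : 'Hom(V, k^o)) v :
  dev (a *: phi + psi) v = a *: dev phi v + dev psi v.
Proof. by rewrite /dev add_lfunE scale_lfunE. Qed.

Lemma devPr V a (phi : 'Hom(V, k^o)) v w :
  dev phi (a *: v + w) = a *: dev phi v + dev phi w.
Proof. exact: linearP. Qed.

Lemma dual_sep V (v w : V) : (forall phi, dev phi v = dev phi w) -> v = w.
Proof.
move=> vw; apply/eqP; rewrite -subr_eq0; apply/negPn/negP => nz.
have [|l _] := @functional_sep k V 0%VS (v - w); first by rewrite memv0.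
by rewrite linearB /= [l v]vw subrr eqxx.
Qed.

Lemma ddual V (F : 'Hom('Hom(V, k^o), k^o)) :
  exists v, forall phi, F phi = dev phi v.
Proof.
pose b := vbasis {:V}.
pose c (i : 'I_(\dim {:V})) : 'Hom(V, k^o) := linfun (coord b i : V -> k^o).
exists (\sum_(i < \dim {:V}) F (c i) *: b`_i) => phi.
have phiE : phi = \sum_(i < \dim {:V}) phi b`_i *: c i.
  apply/lfunP=> v; rewrite sum_lfunE {1}[v](coord_vbasis (memvf v)) linear_sum.
  apply: eq_bigr => i _; rewrite /= linearZ scale_lfunE lfunE /=.
  by rewrite /GRing.scale /= mulrC.
rewrite /dev {1}phiE !linear_sum; apply: eq_bigr => i _.
by rewrite /= !linearZ /= /GRing.scale /= mulrC.
Qed.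

Lemma tr_surj V W (g : 'Hom('Hom(W, k^o), 'Hom(V, k^o))) :
  exists f : 'Hom(V, W), g = tr f.
Proof.
have [v _|a v w v' w' gv gv' phi|f fP] := @lin_choice k V W fullv
    (fun v w => forall phi, dev (g phi) v = dev phi w).
- have [|F FE] := @lfun_exists k 'Hom(W, k^o) k^o (fun phi => dev (g phi) v).
    by move=> a x y; rewrite linearP devPl.
  by have [w wP] := ddual F; exists w => phi; rewrite -FE wP.
- by rewrite !devPr gv gv'.
exists f; apply/lfunP=> phi; apply: dev_ext=> v.
by rewrite dev_tr; apply/fP/memvf.
Qed.

Lemma tr_factor V W (f : 'Hom(V, W)) (psi : 'Hom(V, k^o)) :
  (lker f <= lker psi)%VS -> exists phi, psi = tr f phi.
Proof.
move=> fpsi; exists (psi \o f^-1)%VF; apply/lfunP=> v.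
rewrite trE !comp_lfunE; apply/eqP; rewrite -subr_eq0 -linearB -memv_ker.
apply: (subvP fpsi); rewrite memv_ker linearB /= limg_lfunVK ?subrr //.
exact: limg_mem.
Qed.

Lemma flip_exists V W (f : 'Hom(V, 'Hom(W, k^o))) :
  exists g : 'Hom(W, 'Hom(V, k^o)), forall v w, dev (g w) v = dev (f v) w.
Proof.
have [w _|a w u w' u' uw uw' v|g gP] := @lin_choice k W 'Hom(V, k^o) fullv
    (fun w g => forall v, dev g v = dev (f v) w).
- have [|g gE] := @lfun_exists k V k^o (fun v => dev (f v) w).
    by move=> a x y; rewrite linearP devPl.
  by exists g => v; rewrite /dev gE.
- by rewrite devPl uw uw' devPr.
by exists g => v w; apply/gP/memvf.
Qed.

End Duality.

Section ModuleDuality.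
Variables (k : fieldType) (A : falgType k).
Implicit Types X Y I Q S W : rmodType A.

Definition Dm (R : rmodType (opalg A)) : rmodType A := opopK (dual R).

Lemma dev_dual X (phi : dual X) (a : A) (x : X) :
  @dev k X (phi ** (a : opalg A)) x = @dev k X phi (x ** a).
Proof. exact: dual_actE. Qed.

Lemma dev_Dm (R : rmodType (opalg A)) (phi : Dm R) (a : A) (r : R) :
  @dev k R (phi ** a) r = @dev k R phi (r ** (a : opalg A)).
Proof. exact: (@dual_actE k (opalg A) R phi a r). Qed.

Lemma tr_rhom X Y (f : 'Hom(X, Y)) :
  rhom f -> rhom (tr f : 'Hom(dual Y, dual X)).
Proof.
move=> hf phi a; apply: dev_ext=> x.
by rewrite dev_dual !dev_tr dev_dual hf.
Qed.

Lemma rhom_tr X Y (f : 'Hom(X, Y)) :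
  rhom (tr f : 'Hom(dual Y, dual X)) -> rhom f.
Proof.
move=> hf x a; apply: dual_sep => phi.
have := congr1 (fun psi => dev psi x) (hf phi a).
by rewrite /= dev_dual !dev_tr dev_dual.
Qed.

Lemma flip_to X (R : rmodType (opalg A)) (f : 'Hom(X, Dm R)) : rhom f ->
  exists g : 'Hom(R, dual X), rhom g /\
    forall x r, @dev k X (g r) x = @dev k R (f x) r.
Proof.
move=> hf; have [g gE] := flip_exists (f : 'Hom(X, 'Hom(R, k^o))).
exists g; split=> // r a; apply: dev_ext=> x.
by rewrite gE dev_dual gE hf dev_Dm.
Qed.

Lemma flip_from X (R : rmodType (opalg A)) (g : 'Hom(R, dual X)) : rhom g ->
  exists f : 'Hom(X, Dm R), rhom f /\
    forall x r, @dev k R (f x) r = @dev k X (g r) x.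
Proof.
move=> hg; have [f fE] := flip_exists (g : 'Hom(R, 'Hom(X, k^o))).
exists f; split=> [x a|x r]; last exact: fE.
apply: (@dev_ext k R)=> r.
by rewrite fE dev_Dm fE hg dev_dual.
Qed.

Lemma Dm_injective (R : rmodType (opalg A)) :
  projective R -> injective_mod (Dm R).
Proof.
move=> pR X Y g f hg hf g0.
have [f' [hf' f'E]] := flip_to hf.
have [|h [hh hE]] := pR _ _ _ _ (tr_rhom hg) hf'.
  apply/limg_fullP => phi; apply: tr_factor.
  by rewrite g0 sub0v.
have [h' [hh' h'E]] := flip_from hh.
exists h'; split=> //; apply/lfunP=> x; apply: (@dev_ext k R)=> r.
by rewrite comp_lfunE h'E -f'E -hE comp_lfunE dev_tr.
Qed.

Lemma inj_embedding X : exists I (u : 'Hom(X, I)),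
  [/\ injective_mod I, rhom u & lker u = 0%VS].
Proof.
have [n [p [hp pT]]] := freemod_cover (dual X).
have [u [hu uE]] := flip_from hp.
exists (Dm (freemod _ n)), u; split=> //.
  exact/Dm_injective/freemod_projective.
apply: lker0_of => x y xy; apply: dual_sep => phi.
have /limgP[r ->] : phi \in limg p by rewrite pT memvf.
by rewrite -!uE xy.
Qed.

(** Dual to [proj_cover_exists]: an injective of least dimension containing
    [X] is an injective envelope. *)
Lemma inj_envelope_exists X : exists I (u : 'Hom(X, I)),
  [/\ injective_mod I, rhom u, lker u = 0%VS & essential (limg u)].
Proof.
have [|n [[I [u [[iI hu u0] dI]]] nmin]] := @ex_min (fun n =>
    exists I (u : 'Hom(X, I)),
      [/\ injective_mod I, rhom u & lker u = 0%VS] /\ \dim {:I} = n).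
  by have [I [u uP]] := inj_embedding X; exists (\dim {:I}), I, u.
exists I, u; split=> // U sU Uu.
pose under (h : 'End(I)) :=
  [/\ rhom h, (h \o u)%VF = u & (U <= lker h)%VS].
have [|m [[h [[hh hu' hU] dh]] hmin]] := @ex_min (fun m =>
    exists h, under h /\ \dim (limg h) = m).
  have [Q [p [hp pT pE]]] := quot_exists sU.
  have pu0 : lker (p \o u)%VF = 0%VS.
    apply/eqP; rewrite -subv0; apply/subvP => x.
    rewrite memv_ker comp_lfunE -memv_ker pE => ux.
    have : u x \in (U :&: limg u)%VS by rewrite memv_cap ux limg_mem.
    by rewrite Uu !memv0 -(inj_eq (lker_inj u0)) linear0.
  have [h [h1 h2]] := iI _ _ _ _ (rhom_comp hp hu) hu pu0.
  exists (\dim (limg (h \o p)%VF)), (h \o p)%VF; split=> //; split.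
  - exact: rhom_comp.
  - by rewrite -comp_lfunA.
  - apply/subvP => x; rewrite -pE !memv_ker comp_lfunE => /eqP ->.
    by rewrite linear0.
have [||S [i [s [r [[hi hs] hr isE ri dS]]]]] := @stable_image_retract k A I h.
- done.
- rewrite dh; apply: hmin; exists (h \o h)%VF; split=> //; split.
  + exact: rhom_comp.
  + by rewrite -comp_lfunA !hu'.
  + apply: subv_trans hU _; apply/subvP => x; rewrite !memv_ker comp_lfunE.
    by move/eqP->; rewrite linear0.
have dIS : (\dim {:I} <= \dim (limg h))%N.
  rewrite -dS dI; apply: nmin; exists S, (s \o u)%VF; split=> //; split.
  - exact: inj_retract ri.
  - exact: rhom_comp.
  apply: lker0_of => x y xy; apply: (lker_inj u0).
  by rewrite -hu' -isE -comp_lfunA !comp_lfunE -!(comp_lfunE s u) xy.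
have hT : limg h = fullv by apply/eqP; rewrite eqEdim subvf.
by apply/eqP; rewrite -subv0 -(endo_onto_inj hT).
Qed.

Lemma cosyzygy_exists X : exists W, is_cosyzygy X W.
Proof.
have [I [u [iI hu u0 eu]]] := inj_envelope_exists X.
have [W [p [hp pT pE]]] := quot_exists (submod_limg hu).
by exists W, I, u, p; split=> //; split.
Qed.

Lemma riso_refl X : riso X X.
Proof.
exists \1%VF; split; first exact: rhom_id.
  by apply: lker0_of => x y; rewrite !lfunE.
by apply/limg_fullP => y; exists y; rewrite lfunE.
Qed.

Section LeftMul.
Variable P : rmodType A.

Definition homA_act (f : 'Hom(P, regmod A)) (a : opalg A) :
  'Hom(P, regmod A) := (reg_lmul (a : A) \o f)%VF.
Lemma homA_actE f (a : A) p : homA_act f a p = a * f p :> A.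
Proof. by rewrite comp_lfunE lfunE. Qed.
Fact homA_linearr f : linear (homA_act f).
Proof.
move=> c u v; apply/lfunP=> p; rewrite add_lfunE scale_lfunE !homA_actE.
by rewrite mulrDl scalerAl.
Qed.
Fact homA_linearl a : linear (fun f => homA_act f a).
Proof. by move=> c u v; rewrite /homA_act comp_lfunDr comp_lfunZr. Qed.
Fact homA_act1 f : homA_act f 1 = f.
Proof. by apply/lfunP=> p; rewrite homA_actE mul1r. Qed.
Fact homA_actM f a b : homA_act f (a * b) = homA_act (homA_act f a) b.
Proof.
by apply/lfunP=> p; rewrite homA_actE [RHS]homA_actE homA_actE mulrA.
Qed.
Definition homA : rmodType (opalg A) :=
  RMod homA_linearr homA_linearl homA_act1 homA_actM.

End LeftMul.

Lemma reg_lmul_rhom (a : A) : rhom (reg_lmul a).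
Proof. by move=> x b; rewrite !lfunE /= mulrA. Qed.

(** The quotient by the coboundaries is formed first, inside all linear maps
    [P1 -> A], and the image of the homomorphisms is taken afterwards. *)
Lemma Tr_exists X : exists N, is_Tr X N.
Proof.
have [P1 [P0 [p1 [p0 pP]]]] := min_presentation_exists X.
have hp1 := mpp_hom1 pP.
pose bd (f : homA P1) :=
  exists g : 'Hom(P0, regmod A), rhom g /\ f = (g \o p1)%VF.
have [||B BP] := @subspace_exists k (homA P1) bd.
- by exists 0; split; [apply: rhom0|rewrite comp_lfun0l].
- move=> a _ _ [u [hu ->]] [v [hv ->]]; exists (a *: u + v); split.
    by apply: rhomD => //; apply: rhomZ.
  by rewrite comp_lfunDl comp_lfunZl.
have sB : submod B.
  move=> f a /BP[g [hg ->]]; apply/BP; exists (reg_lmul (a : A) \o g)%VF.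
  split; first by apply: rhom_comp => //; apply: reg_lmul_rhom.
  by rewrite -comp_lfunA.
have [||H HP] := @subspace_exists k (homA P1) (fun f => rhom f).
- exact: rhom0.
- by move=> a u v hu hv; apply: rhomD => //; apply: rhomZ.
have sH : submod H.
  by move=> f a /HP hf; apply/HP/rhom_comp => //; apply: reg_lmul_rhom.
have [Q [p [hp pT pE]]] := quot_exists sB.
have [S [i [hi i0 iE]]] := sub_exists sH.
have [N [j [hj j0 jE]]] := sub_exists (submod_limg (rhom_comp hp hi)).
have [f fH|a f n f' n' fn fn'|q qP] := @lin_choice k (homA P1) N H
    (fun f n => j n = p f).
- have /limgP[n nE] : p f \in limg j.
    rewrite jE; move: fH; rewrite -iE => /limgP[s ->].
    by rewrite -comp_lfunE limg_mem.
  by exists n.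
- by rewrite !linearP /= fn fn'.
exists N, P1, P0, p1, p0, q; split=> //.
- move=> n; have : j n \in limg j by apply: limg_mem.
  rewrite jE => /limgP[s nE]; exists (i s).
  have iH : i s \in H by rewrite -iE limg_mem.
  split; first exact/HP.
  by apply: (lker_inj j0); rewrite qP // nE comp_lfunE.
- move=> f hf; have fH : (f : homA P1) \in H by apply/HP.
  have -> : q f = 0 <-> f \in B.
    rewrite -pE memv_ker -qP //; split=> [->|/eqP jq]; first by rewrite linear0.
    by apply: (lker_inj j0); rewrite jq linear0.
  exact: BP.
- move=> a f hf; have fH : (f : homA P1) \in H by apply/HP.
  apply: (lker_inj j0); rewrite hj !qP //; first exact: hp f (a : opalg A).
  exact: (sH f (a : opalg A)).
Qed.

End ModuleDuality.

(** * Vanishing of extensions *)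

Section Extensions.
Variables (k : fieldType) (A : falgType k).
Implicit Types X Y Z P I S Q K T V : rmodType A.

(** [Ext^1(X, Z) = 0], phrased with an arbitrary extension [S -> V -> X] rather
    than a projective presentation, so that it applies to any middle term. *)
Definition ext_vanish X Z : Prop :=
  forall S V (i : 'Hom(S, V)) (p : 'Hom(V, X)) (th : 'Hom(S, Z)),
    short_exact i p -> rhom th -> exists th' : 'Hom(V, Z),
    rhom th' /\ (th' \o i)%VF = th.

Lemma dsum_couniv X Y Z (f : 'Hom(X, Z)) (g : 'Hom(Y, Z)) : rhom f -> rhom g ->
  exists h : 'Hom(dsum X Y, Z), rhom h /\ forall x y, h (x, y) = f x + g y.
Proof.
move=> hf hg.
have [|h hE] := @lfun_exists k (dsum X Y) Z (fun z : X * Y => f z.1 + g z.2).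
  by move=> a u v; rewrite /= !linearP scalerDr addrACA.
exists h; split=> [[x y] a|x y]; last by rewrite hE.
by rewrite !hE /= hf hg ractDl.
Qed.

(** With [V] the middle term of an extension of [X], a projective presentation
    [K -> P -> X] maps to it, and [V] is then the pushout of [S <- K -> P];
    so extending along [K -> P] is enough. *)
Lemma ext_vanish_proj K P X Z (kap : 'Hom(K, P)) (pi : 'Hom(P, X)) :
    projective P -> short_exact kap pi ->
    (forall th : 'Hom(K, Z), rhom th ->
       exists th' : 'Hom(P, Z), rhom th' /\ (th' \o kap)%VF = th) ->
  ext_vanish X Z.
Proof.
move=> pP [[hkap hpi] kap0 kapE piT] ext S V i p th [[hi hp] i0 iE pT] hth.
have [t [ht tE]] := pP _ _ _ _ hp hpi pT.
have [|s [hs sE]] := factor_mono hi (rhom_comp ht hkap) i0.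
  apply/subvP => _ /limgP[x ->]; rewrite iE memv_ker -comp_lfunE comp_lfunA tE.
  by rewrite comp_lfunE -memv_ker -kapE limg_mem.
have [psi [hpsi psiE]] := ext _ (rhom_comp hth hs).
have [f [hf fE]] := dsum_couniv hi ht.
have [g [hg gE]] := dsum_couniv hth hpsi.
have fT : limg f = fullv.
  apply/limg_fullP => v.
  have /limgP[x xE] : p v \in limg pi by rewrite piT memvf.
  have : v - t x \in limg i.
    by rewrite iE memv_ker linearB /= -(comp_lfunE p t) tE xE subrr.
  by case/limgP=> y yE; exists (y, x); rewrite fE -yE subrK.
have [|h [hh hE]] := factor_epi hf hg fT.
  apply/subvP => [[y x]]; rewrite !memv_ker fE gE => /eqP yx.
  have : x \in limg kap.
    have piy : p (i y) = 0 by apply/eqP; rewrite -memv_ker -iE limg_mem.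
    rewrite kapE memv_ker -tE comp_lfunE.
    by move: (linearD p (i y) (t x)); rewrite /= yx linear0 piy add0r => <-.
  case/limgP=> z zE; move: yx; rewrite zE -(comp_lfunE t kap) -sE comp_lfunE.
  rewrite -linearD -(linear0 i) => /(lker_inj i0) yz.
  by rewrite -(comp_lfunE psi kap) psiE comp_lfunE -linearD yz linear0.
exists h; split=> //; apply/lfunP=> y; rewrite comp_lfunE.
have := fE y 0; rewrite linear0 addr0 => <-.
by rewrite -(comp_lfunE h f) hE gE linear0 addr0.
Qed.

(** Maps extend first to the preimage of [X1] in the middle term, then to all
    of it. *)
Lemma ext_vanish_extension X1 X X2 Z (a : 'Hom(X1, X)) (b : 'Hom(X, X2)) :
  short_exact a b -> ext_vanish X1 Z -> ext_vanish X2 Z -> ext_vanish X Z.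
Proof.
move=> [[ha hb] a0 aE bT] e1 e2 S V i p th [[hi hp] i0 iE pT] hth.
have [V1 [j [p1 [hj hp1 j0 p1E jS]]]] := pullback_mono ha hp a0.
have [|i1 [hi1 i1E]] := factor_mono hj hi j0.
  by apply/subvP => v; rewrite iE memv_ker => /eqP pv; rewrite jS ?pv ?mem0v.
have p1K x : (p1 x == 0) = (p (j x) == 0).
  by rewrite -(comp_lfunE p j) -p1E comp_lfunE -(inj_eq (lker_inj a0)) linear0.
have se1 : short_exact i1 p1.
  split=> //.
  - apply: lker0_of => x y xy; apply: (lker_inj i0).
    by rewrite -i1E !comp_lfunE xy.
  - apply/vspaceP => x; rewrite memv_ker p1K -memv_ker -iE -i1E.
    apply/limgP/limgP => [[y ->]|[y]]; first by exists y; rewrite comp_lfunE.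
    by rewrite comp_lfunE => /(lker_inj j0) ->; exists y.
  - apply/limg_fullP => x.
    have /limgP[v vE] : a x \in limg p by rewrite pT memvf.
    have /limgP[w wE] : v \in limg j by rewrite jS -?vE ?limg_mem.
    exists w; apply: (lker_inj a0).
    by rewrite -(comp_lfunE a p1) p1E comp_lfunE -wE.
have [th1 [hth1 th1E]] := e1 _ _ _ _ _ se1 hth.
have se2 : short_exact j (b \o p)%VF.
  split=> //; first by split=> //; apply: rhom_comp.
    apply/vspaceP => v; rewrite memv_ker comp_lfunE -memv_ker -aE.
    apply/idP/idP => [/limgP[w ->]|/jS//].
    by rewrite -(comp_lfunE p j) -p1E comp_lfunE limg_mem.
  apply/limg_fullP => x; have /limgP[y ->] : x \in limg b by rewrite bT memvf.
  have /limgP[v ->] : y \in limg p by rewrite pT memvf.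
  by exists v; rewrite comp_lfunE.
have [th2 [hth2 th2E]] := e2 _ _ _ _ _ se2 hth1.
by exists th2; split=> //; rewrite -i1E comp_lfunA th2E.
Qed.

Lemma rpow0_eq0 X (x : rpow X 0) : x = 0.
Proof. by apply/ffunP => -[]. Qed.

Lemma ext_vanish_rpowl T Z n : ext_vanish T Z -> ext_vanish (rpow T n) Z.
Proof.
move=> eT; elim: n => [|n IHn].
  move=> S V i p th [[hi hp] i0 iE pT] hth.
  have iT : limg i = fullv.
    rewrite iE; apply/vspaceP => v; rewrite memvf memv_ker.
    exact/eqP/rpow0_eq0.
  have [g [hg _ gi]] := iso_inv hi i0 iT.
  exists (th \o g)%VF; split; first exact: rhom_comp.
  by rewrite -comp_lfunA gi comp_lfun1r.
have [b [hb bE]] := @rpow_proj k A T n.+1 ord0.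
have [pr prE] : exists pr : 'I_n -> 'Hom(rpow T n, T), forall i,
    rhom (pr i) /\ forall v : {ffun 'I_n -> T}, pr i v = v i.
  apply: (@fin_all_exists _ (fun=> 'Hom(rpow T n, T)) (fun i c =>
     rhom c /\ forall v : {ffun 'I_n -> T}, c v = v i)) => i.
  exact: rpow_proj.
pose pr' (i : 'I_n.+1) := if unlift ord0 i is Some j then pr j else 0.
have [|a [ha aE]] := @rpow_univ k A T (rpow T n) n.+1 pr'.
  rewrite /pr' => i; case: (unlift ord0 i) => [j|]; last exact: rhom0.
  by case: (prE j).
apply: (ext_vanish_extension (a := a) (b := b)) IHn eT; split=> //.
- apply: lker0_of => v w vw; apply/ffunP => i.
  have := congr1 (fun z : {ffun 'I_n.+1 -> T} => z (lift ord0 i)) vw.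
  by rewrite /= !aE /pr' liftK !(prE i).2.
- apply/vspaceP => v; rewrite memv_ker bE; apply/limgP/eqP => [[w ->]|v0].
    by rewrite aE /pr' unlift_none lfunE.
  pose w i := (v : {ffun 'I_n.+1 -> T}) (lift ord0 i).
  exists ([ffun i => w i] : {ffun 'I_n -> T}).
  apply/ffunP => i; rewrite aE /pr'; case: unliftP => [j ->|->].
    by rewrite (prE j).2 ffunE.
  by rewrite lfunE.
- apply/limg_fullP => x; exists ([ffun=> x] : {ffun 'I_n.+1 -> T}).
  by rewrite bE ffunE.
Qed.

Lemma ext_vanish_rpowr X Y n : ext_vanish X Y -> ext_vanish X (rpow Y n).
Proof.
move=> eXY S V i p th se hth.
have [t tP] : exists t : 'I_n -> 'Hom(V, Y), forall l, rhom (t l) /\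
    forall s, t l (i s) = (th s : {ffun 'I_n -> Y}) l.
  apply: (@fin_all_exists _ (fun=> 'Hom(V, Y)) (fun l t => rhom t /\
    forall s, t (i s) = (th s : {ffun 'I_n -> Y}) l)) => l.
  have [pr [hpr prE]] := rpow_proj Y l.
  have [t [ht tE]] := eXY _ _ _ _ _ se (rhom_comp hpr hth).
  by exists t; split=> // s; rewrite -(comp_lfunE t i) tE comp_lfunE prE.
have [g [hg gE]] := rpow_univ (fun l => (tP l).1).
exists g; split=> //; apply/lfunP=> s; apply/ffunP => l.
by rewrite comp_lfunE gE (tP l).2.
Qed.

Section ShortResolution.
Variables (P1 P0 : rmodType A) (f : 'Hom(P1, P0)).

Definition short_obj (n : nat) : rmodType A :=
  match n with 0 => P0 | 1 => P1 | _ => freemod A 0 end.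

Definition short_diff (n : nat) : 'Hom(short_obj n.+1, short_obj n) :=
  match n with 0 => f | _ => 0 end.

Lemma short_resolution X (g : 'Hom(P0, X)) :
  projective P1 -> projective P0 -> short_exact f g ->
  @proj_resolution k A X short_obj short_diff g.
Proof.
move=> pP1 pP0 [[hf hg] f0 fE gT]; split=> //.
- by case=> [|[|n]] //=; apply: freemod_projective.
- by case=> [|n] //=; apply: rhom0.
- case=> [|n]; apply/vspaceP => x; rewrite ?f0 ?memv0.
    by apply/limgP/eqP => [[y ->]|->]; [|exists 0]; rewrite lfunE.
  rewrite memv_ker lfunE eqxx; apply/limgP; exists 0; rewrite linear0.
  exact: rpow0_eq0.
Qed.

End ShortResolution.

Lemma Ext1_eq0_vanish X Y : pd_le1 X -> Ext1_eq0 X Y -> ext_vanish X Y.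
Proof.
move=> [P1 [P0 [f [g [pP1 pP0 se]]]]] e.
apply: (ext_vanish_proj pP0 se) => th hth.
have [|h [hh ->]] := e _ _ _ (short_resolution pP1 pP0 se) th.
- by split=> //; rewrite /= comp_lfun0r.
by exists h.
Qed.

(** Projective dimension at most 1 makes [Ext^1(X, -)] right exact: with
    [P1 -> P0] a resolution of [X], a map [P1 -> Z] lifts to a power of [Y]. *)
Lemma ext_vanish_Gen X Y Z :
  pd_le1 X -> ext_vanish X Y -> in_Gen Y Z -> ext_vanish X Z.
Proof.
move=> [P1 [P0 [f [g [pP1 pP0 se]]]]] eXY [n [q [hq qT]]].
apply: (ext_vanish_proj pP0 se) => th hth.
have [t [ht tE]] := pP1 _ _ _ _ hq hth qT.
have [t' [ht' t'E]] := ext_vanish_rpowr (n := n) eXY se ht.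
exists (q \o t')%VF; split; first exact: rhom_comp.
by rewrite -comp_lfunA t'E.
Qed.

End Extensions.

Section TauRigid.
Variables (k : fieldType) (A : falgType k).
Implicit Types X Y Z P I S Q K T V : rmodType A.

Definition scal P X (x : X) (phi : 'Hom(P, regmod A)) : 'Hom(P, X) :=
  (linfun (@ract k A X x) \o phi)%VF.

Lemma scalE P X (x : X) (phi : 'Hom(P, regmod A)) p :
  scal x phi p = x ** (phi p : A).
Proof. by rewrite comp_lfunE lfunE. Qed.

Lemma rhom_scal P X (x : X) (phi : 'Hom(P, regmod A)) :
  rhom phi -> rhom (scal x phi).
Proof. by move=> hphi p a; rewrite !scalE hphi /= ractM. Qed.

Lemma scalPl P X a (x y : X) (phi : 'Hom(P, regmod A)) :
  scal (a *: x + y) phi = a *: scal x phi + scal y phi.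
Proof.
by apply/lfunP=> p; rewrite add_lfunE scale_lfunE !scalE ractDl ractZl.
Qed.

Lemma scalPr P X a (x : X) (phi psi : 'Hom(P, regmod A)) :
  scal x (a *: phi + psi) = a *: scal x phi + scal x psi.
Proof.
by apply/lfunP=> p; rewrite !(add_lfunE, scale_lfunE, scalE) linearP.
Qed.

Lemma scal_lmul P X (x : X) a (phi : 'Hom(P, regmod A)) :
  scal (x ** a) phi = scal x (reg_lmul a \o phi)%VF.
Proof.
by apply/lfunP=> p; rewrite scalE [RHS]scalE comp_lfunE lfunE /= ractM.
Qed.

Lemma scal_comp P Q X (x : X) (phi : 'Hom(P, regmod A)) (h : 'Hom(Q, P)) :
  (scal x phi \o h)%VF = scal x (phi \o h)%VF.
Proof. by rewrite -comp_lfunA. Qed.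

Lemma dual_basis_scal P X n (u : 'I_n -> P) chi (g : 'Hom(P, X)) :
  dual_basis u chi -> rhom g -> g = \sum_i scal (g (u i)) (chi i).
Proof.
move=> [_ uE] hg; apply/lfunP=> p; rewrite sum_lfunE {1}[p]uE linear_sum.
by apply: eq_bigr => i _; rewrite /= hg scalE.
Qed.

(** * The criterion of Auslander and Smalo *)

Section HomTau.
Variables (X P1 P0 : rmodType A) (N : rmodType (opalg A)).
Variables (p1 : 'Hom(P1, P0)) (q : 'Hom('Hom(P1, regmod A), N)).
Hypotheses (pP1 : projective P1) (pP0 : projective P0) (hp1 : rhom p1).
Hypothesis q_onto : forall y : N, exists f, rhom f /\ q f = y.
Hypothesis q_ker : forall f, rhom f ->
  (q f = 0 <-> exists g : 'Hom(P0, regmod A), rhom g /\ f = (g \o p1)%VF).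
Hypothesis q_act : forall (a : A) f, rhom f ->
  q (reg_lmul a \o f)%VF = q f ** (a : opalg A).

(** [Hom(X, D N)] is dual to [X (x) N], and since [N] is the cokernel of
    [Hom(P0, A) -> Hom(P1, A)], it is dual to the cokernel of
    [Hom(P0, X) -> Hom(P1, X)].  The functional on [Hom(P1, X)] that belongs to
    [f] is [Phi] below, given by a dual basis of [P1]. *)
Lemma onto_hom_tau0 (f : 'Hom(X, Dm N)) :
    (forall g : 'Hom(P1, X), rhom g ->
       exists h : 'Hom(P0, X), rhom h /\ g = (h \o p1)%VF) ->
  rhom f -> f = 0.
Proof.
move=> ext hf.
have [n [u [chi db]]] := proj_dual_basis pP1.
have [m [w [om db0]]] := proj_dual_basis pP0.
pose Phi (g : 'Hom(P1, X)) : k^o :=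
  \sum_i @dev k N (f (g (u i))) (q (chi i)).
have PhiS x phi : rhom phi -> Phi (scal x phi) = @dev k N (f x) (q phi).
  move=> hphi; rewrite {2}(dual_basis_scal db hphi) /dev !linear_sum.
  apply: eq_bigr => i _ /=; rewrite scalE hf [LHS]dev_Dm.
  rewrite -q_act; last exact: db.1.
  by congr (dev _ (q _)).
have Phi_sum l (g : 'I_l -> 'Hom(P1, X)) : Phi (\sum_j g j) = \sum_j Phi (g j).
  rewrite /Phi exchange_big; apply: eq_bigr => i _ /=.
  rewrite sum_lfunE linear_sum /dev sum_lfunE; exact: eq_bigr.
apply/lfunP=> x; rewrite lfunE; apply: (@dev_ext k N) => y.
have [phi [hphi <-]] := q_onto y; rewrite -PhiS // dev0l.
have [h [hh ->]] := ext _ (rhom_scal x hphi).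
have -> : (h \o p1)%VF = \sum_j scal (h (w j)) (om j \o p1)%VF.
  rewrite {1}(dual_basis_scal db0 hh); apply/lfunP=> p.
  rewrite comp_lfunE !sum_lfunE; apply: eq_bigr => j _.
  by rewrite !scalE comp_lfunE.
rewrite Phi_sum big1 // => j _.
have hom_p1 : rhom (om j \o p1)%VF by apply: rhom_comp => //; apply: db0.1.
have q0 : q (om j \o p1)%VF = 0.
  by apply/(q_ker hom_p1); exists (om j); split=> //; apply: db0.1.
by rewrite PhiS // q0 dev0r.
Qed.

(** The same duality read backwards: a functional on [Hom(P1, X)] vanishing on
    the image of [Hom(P0, X)] defines a homomorphism from [X] to [D N]. *)
Lemma hom_tau0_onto (g : 'Hom(P1, X)) :
    (forall f : 'Hom(X, Dm N), rhom f -> f = 0) -> rhom g ->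
  exists h : 'Hom(P0, X), rhom h /\ g = (h \o p1)%VF.
Proof.
move=> f0 hg.
have [||U UP] := @subspace_exists k 'Hom(P1, X) (fun g =>
    exists h : 'Hom(P0, X), rhom h /\ g = (h \o p1)%VF).
- by exists 0; split; [apply: rhom0|rewrite comp_lfun0l].
- move=> a _ _ [x [hx ->]] [y [hy ->]]; exists (a *: x + y); split.
    by apply: rhomD => //; apply: rhomZ.
  by rewrite comp_lfunDl comp_lfunZl.
apply/UP/negPn/negP => /functional_sep[lam lamU /eqP lamg]; apply: lamg.
have [||H HP] := @subspace_exists k 'Hom(P1, regmod A) (fun f => rhom f).
- exact: rhom0.
- by move=> a x y hx hy; apply: rhomD => //; apply: rhomZ.
have [|s sP] := @lfun_section k _ _ q H.
  by move=> y; have [f [/HP]] := q_onto y; exists f.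
have [x _|a x y x' y' xy xy' phi hphi|f fP] :=
    @lin_choice k X 'Hom(N, k^o) fullv (fun x y =>
    forall phi, rhom phi -> dev y (q phi) = lam (scal x phi)).
- have [|y yE] := @lfun_exists k N k^o (fun n => lam (scal x (s n))).
    by move=> a n n'; rewrite linearP scalPr linearP.
  exists y => phi hphi; rewrite /dev yE.
  have [sH sq] := sP (q phi); move/HP: sH => hs.
  apply/eqP; rewrite -subr_eq0 -linearB; apply/eqP/lamU/UP.
  have hd : rhom (s (q phi) - phi) by apply: rhomB.
  have [|t [ht tE]] := (q_ker hd).1; first by rewrite linearB /= sq subrr.
  exists (scal x t); split; first exact: rhom_scal.
  rewrite scal_comp -tE; apply/lfunP=> p.
  by rewrite !(add_lfunE, opp_lfunE, scalE) linearB.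
- by rewrite devPl xy // xy' // scalPl linearP.
have hf : rhom (f : 'Hom(X, Dm N)).
  move=> x a; apply: (@dev_ext k N) => n.
  have [phi [hphi <-]] := q_onto n.
  rewrite fP ?memvf // dev_Dm scal_lmul -q_act // fP ?memvf //.
  by apply: rhom_comp => //; apply: reg_lmul_rhom.
have [n [u [chi db]]] := proj_dual_basis pP1.
rewrite (dual_basis_scal db hg) linear_sum big1 // => i _ /=.
by rewrite -fP ?memvf //; [rewrite (f0 _ hf) lfunE dev0l|apply: db.1].
Qed.

End HomTau.

(** Auslander and Smalo: [Hom(X, tau X) = 0] means that [Hom(-, X)] is onto
    along a minimal presentation [P1 -> P0] of [X].  From this, maps into a
    quotient of some [X^n] lift and extend.  Conversely let [g : P1 -> X] be
    given and let [K] be the kernel of [P1 -> P0]; modulo [g(K)] the map [g]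
    extends to [P0], so [g] may be corrected to have [g(P1) = g(K)], and since
    [K] is superfluous the corrected map vanishes. *)
Lemma tau_rigid_ext X :
  tau_rigid X <-> forall Z, in_Gen X Z -> ext_vanish X Z.
Proof.
split=> [rig Z [n [e [he eT]]]|van Y].
  have [N [P1 [P0 [p1 [p0 [q [pP qS qK qA]]]]]]] := Tr_exists X.
  have pP1 := mpp_proj1 pP; have pP0 := mpp_proj0 pP.
  have hp1 := mpp_hom1 pP; have hp0 := mpp_hom0 pP.
  have f0 (f : 'Hom(X, Dm N)) : rhom f -> f = 0.
    apply: rig; exists N; split; last exact: riso_refl.
    by exists P1, P0, p1, p0, q.
  have ext (g : 'Hom(P1, X)) (hg : rhom g) :=
    hom_tau0_onto pP1 qS qK qA f0 hg.
  have [S [i [r [[hi hr i0 rT rE] iE]]]] := image_factor hp1.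
  have se : short_exact i p0.
    by split=> //; [rewrite iE (mpp_exact pP)|apply: mpp_epi pP].
  apply: (ext_vanish_proj pP0 se) => th hth.
  have [t [ht tE]] := pP1 _ _ _ _ he (rhom_comp hth hr) eT.
  have [h hP] : exists h : 'I_n -> 'Hom(P0, X), forall l, rhom (h l) /\
      forall p, (t p : {ffun 'I_n -> X}) l = h l (p1 p).
    apply: (@fin_all_exists _ (fun=> 'Hom(P0, X)) (fun l h => rhom h /\
      forall p, (t p : {ffun 'I_n -> X}) l = h (p1 p))) => l.
    have [pr [hpr prE]] := rpow_proj X l.
    have [h [hh hE]] := ext _ (rhom_comp hpr ht).
    exists h; split=> // p; have /lfunP/(_ p) := hE.
    by rewrite !comp_lfunE prE.
  have [t' [ht' t'E]] := rpow_univ (fun l => (hP l).1).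
  exists (e \o t')%VF; split; first exact: rhom_comp.
  apply/lfunP=> s; have /limgP[p ->] : s \in limg r by rewrite rT memvf.
  rewrite -[in RHS]comp_lfunE -tE !comp_lfunE -(comp_lfunE i r) rE; congr (e _).
  by apply/ffunP => l; rewrite t'E (hP l).2.
move=> [N [[P1 [P0 [p1 [p0 [q [pP qS qK qA]]]]]] [j [hj j0 _]]]] f hf.
have pP1 := mpp_proj1 pP; have pP0 := mpp_proj0 pP.
have hp1 := mpp_hom1 pP; have hp0 := mpp_hom0 pP.
suff jf0 : (j \o f)%VF = 0.
  apply/lfunP=> x; apply: (lker_inj j0).
  by rewrite -comp_lfunE jf0 !lfunE linear0.
apply: (onto_hom_tau0 pP1 pP0 hp1 qS qK qA); last exact: rhom_comp.
move=> g hg.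
have [K [c [hc c0 cE]]] := sub_exists (submod_lker hp1).
have [Z [z [hz zT zE]]] := quot_exists (submod_limg (rhom_comp hg hc)).
have genZ : in_Gen X Z.
  have [|e [he eE]] := @rpow_couniv k A X Z 1 (fun=> z); first by [].
  exists 1%N, e; split=> //; apply/limg_fullP => y.
  have /limgP[x ->] : y \in limg z by rewrite zT memvf.
  by exists ([ffun=> x] : {ffun 'I_1 -> X}); rewrite eE big_ord1 ffunE.
have [S [i [r [[hi hr i0 rT rE] iE]]]] := image_factor hp1.
have se : short_exact i p0.
  by split=> //; [rewrite iE (mpp_exact pP)|apply: mpp_epi pP].
have [|th [hth thE]] := factor_epi hr (rhom_comp hz hg) rT.
  apply/subvP => x xr.
  have : x \in limg c.
    move: xr; rewrite cE !memv_ker -rE comp_lfunE => /eqP ->.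
    by rewrite linear0.
  case/limgP=> y ->; rewrite memv_ker comp_lfunE -memv_ker zE.
  by rewrite -comp_lfunE limg_mem.
have [th' [hth' th'E]] := van _ genZ _ _ _ _ _ se hth.
have [h [hh hE]] := pP0 _ _ _ _ hz hth' zT.
exists h; split=> //; apply/eqP; rewrite -subr_eq0.
pose g' := g - (h \o p1)%VF; rewrite -/g'.
have hg' : rhom g' by apply: rhomB => //; apply: rhom_comp.
have g'c y : g' (c y) = g (c y).
  rewrite add_lfunE opp_lfunE comp_lfunE.
  have : c y \in lker p1 by rewrite -cE limg_mem.
  by rewrite memv_ker => /eqP ->; rewrite linear0 subr0.
suff kT : lker g' = fullv.
  apply/eqP/lfunP=> x; have : x \in lker g' by rewrite kT memvf.
  by rewrite memv_ker => /eqP ->; rewrite lfunE.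
apply: (mpp_min1 pP); first exact: submod_lker.
apply/vspaceP => x; rewrite memvf.
have : g' x \in lker z.
  rewrite memv_ker add_lfunE opp_lfunE linearB /=.
  rewrite -!(comp_lfunE z) comp_lfunA hE.
  by rewrite -rE comp_lfunA th'E thE subrr.
rewrite zE => /limgP[y yE].
apply/memv_addP; exists (x - c y).
  by rewrite memv_ker linearB /= g'c yE comp_lfunE subrr.
by exists (c y); rewrite ?subrK // -cE limg_mem.
Qed.

End TauRigid.

(** * The global dimension of a tilted algebra *)

Section Hereditary.
Variables (k : fieldType) (A : falgType k).
Implicit Types X Y Z P I S Q K T V L : rmodType A.

(** In a projective presentation of [Y], the preimage of a submodule [X] is
    again projective, so it presents [X] with the same kernel. *)
Lemma ext_vanish_sub X Y Z (i : 'Hom(X, Y)) :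
  hereditary A -> rhom i -> lker i = 0%VS -> ext_vanish Y Z -> ext_vanish X Z.
Proof.
move=> her hi i0 eY.
have [n [pi [hpi piT]]] := freemod_cover Y.
have pP := @freemod_projective k A n.
have [P' [j [pi' [hj hpi' j0 pi'E jS]]]] := pullback_mono hi hpi i0.
have [K [kap [hkap kap0 kapE]]] := sub_exists (submod_lker hpi).
have [|kap' [hkap' kap'E]] := factor_mono hj hkap j0.
  by apply/subvP => x; rewrite kapE memv_ker => /eqP px; rewrite jS ?px ?mem0v.
have se : short_exact kap pi by [].
have pi'K x : (pi' x == 0) = (pi (j x) == 0).
  rewrite -(comp_lfunE pi j) -pi'E comp_lfunE.
  by rewrite -(inj_eq (lker_inj i0)) linear0.
have se' : short_exact kap' pi'.
  split=> //.
  - apply: lker0_of => x y xy; apply: (lker_inj kap0).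
    by rewrite -kap'E !comp_lfunE xy.
  - apply/vspaceP => x; rewrite memv_ker pi'K -memv_ker -kapE -kap'E.
    apply/limgP/limgP => [[y ->]|[y]]; first by exists y; rewrite comp_lfunE.
    by rewrite comp_lfunE => /(lker_inj j0) ->; exists y.
  - apply/limg_fullP => x.
    have /limgP[v vE] : i x \in limg pi by rewrite piT memvf.
    have /limgP[u uE] : v \in limg j by rewrite jS -?vE ?limg_mem.
    exists u; apply: (lker_inj i0).
    by rewrite -(comp_lfunE i pi') pi'E comp_lfunE -uE.
apply: (ext_vanish_proj (her _ _ _ pP hj j0) se') => th hth.
have [th' [hth' th'E]] := eY _ _ _ _ _ se hth.
exists (th' \o j)%VF; split; first exact: rhom_comp.
by rewrite -comp_lfunA kap'E.
Qed.

(** The kernel [L] of [g] inherits [Ext(T, L) = 0] because maps from [T] lift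
    along [g]; hence [Ext(T^m, L) = 0], and then [Ext(S, L) = 0] because the
    algebra is hereditary. *)
Lemma rigid_cover_split T S m r (i : 'Hom(S, rpow T m))
    (g : 'Hom(rpow T r, S)) :
    hereditary A -> ext_vanish T T -> rhom i -> lker i = 0%VS ->
    rhom g -> limg g = fullv ->
    (forall xi : 'Hom(T, S), rhom xi ->
       exists eta : 'Hom(T, rpow T r), rhom eta /\ (g \o eta)%VF = xi) ->
  exists s : 'Hom(S, rpow T r), rhom s /\ (g \o s)%VF = \1%VF.
Proof.
move=> her eTT hi i0 hg gT lift.
have [L [c [hc c0 cE]]] := sub_exists (submod_lker hg).
have eTL : ext_vanish T L.
  move=> S0 V j p th se hth; have [[hj hp] j0 jE pT] := se.
  have [Phi [hPhi PhiE]] := ext_vanish_rpowr (n := r) eTT se (rhom_comp hc hth).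
  have [|xi [hxi xiE]] := factor_epi hp (rhom_comp hg hPhi) pT.
    apply/subvP => x; rewrite -jE => /limgP[y ->].
    rewrite memv_ker comp_lfunE -(comp_lfunE Phi j) PhiE comp_lfunE.
    by rewrite -memv_ker -cE limg_mem.
  have [eta [heta etaE]] := lift xi hxi.
  have hd : rhom (Phi - (eta \o p))%VF by apply/rhomB => //; apply: rhom_comp.
  have [|th' [hth' th'E]] := factor_mono hc hd c0.
    apply/subvP => _ /limgP[x ->]; rewrite cE memv_ker -comp_lfunE.
    by rewrite comp_lfunDr comp_lfunNr comp_lfunA etaE xiE subrr lfunE.
  exists th'; split=> //; apply/lfunP=> y; apply: (lker_inj c0).
  rewrite comp_lfunE -(comp_lfunE c th') th'E add_lfunE opp_lfunE.
  rewrite -(comp_lfunE Phi j) PhiE !comp_lfunE.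
  have : j y \in lker p by rewrite -jE limg_mem.
  by rewrite memv_ker => /eqP ->; rewrite linear0 subr0.
have eSL := ext_vanish_sub her hi i0 (ext_vanish_rpowl (n := m) eTL).
have se : short_exact c g by [].
have [rho [hrho rhoE]] := eSL _ _ _ _ _ se (@rhom_id _ _ L).
have hd : rhom (\1%VF - (c \o rho)%VF).
  by apply/rhomB; [apply: rhom_id|apply: rhom_comp].
have [|s [hs sE]] := factor_epi hg hd gT.
  apply/subvP => x; rewrite -cE => /limgP[y ->].
  rewrite memv_ker add_lfunE opp_lfunE id_lfunE comp_lfunE.
  by rewrite -(comp_lfunE rho c) rhoE id_lfunE subrr.
exists s; split=> //; apply/lfunP=> x.
have /limgP[y ->] : x \in limg g by rewrite gT memvf.
rewrite comp_lfunE -(comp_lfunE s g) sE add_lfunE opp_lfunE !id_lfunE.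
rewrite linearB /= comp_lfunE.
have : c (rho y) \in lker g by rewrite -cE limg_mem.
by rewrite memv_ker => /eqP ->; rewrite subr0.
Qed.

End Hereditary.

(** Global dimension at most 2: second syzygies are projective. *)
Definition gldim_le2 (k : fieldType) (C : falgType k) : Prop :=
  forall (P1 P0 S : rmodType C) (f : 'Hom(P1, P0)) (i : 'Hom(S, P1)),
    projective P1 -> projective P0 -> rhom f -> rhom i ->
    lker i = 0%VS -> limg i = lker f -> projective S.

Section Tilted.
Variables (k : fieldType) (A C : falgType k) (T : rmodType A).
Variable phi : 'Hom(C, 'End(T)).
Hypotheses (her : hereditary A) (eTT : ext_vanish T T).
Hypotheses (phi0 : lker phi = 0%VS).
Hypothesis phiP : forall f : 'End(T), rhom f <-> exists c, f = phi c.
Hypothesis phiM : forall a b, phi (a * b) = (phi a \o phi b)%VF.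

(** [Hom(T, -)] turns [C^m] into [T^m], and an element [x] of the kernel [S] of
    [F] into a map [T -> T^m].  The images of these maps for a basis [kap] of
    [S] span the image [ST] of [G : T^r -> T^m].  Any map [T -> ST] comes from
    an element of [S], that is, from a combination of the [kap l], and so it
    lifts to [T^r]; hence [T^r -> ST] has a section [s].  Composing with [s]
    and returning to [C] exhibits [S] as a direct summand of [C^r]. *)
Lemma ker_free_projective m n (F : 'Hom(freemod C m, freemod C n))
    (S : rmodType C)
    (i : 'Hom(S, freemod C m)) :
  rhom F -> rhom i -> lker i = 0%VS -> limg i = lker F -> projective S.
Proof.
move=> hF hi i0 iE.
have hphi c : rhom (phi c) by apply/phiP; exists c.
pose r := \dim {:S}; pose kap (l : 'I_r) := (vbasis {:S})`_l : S.
pose M (v : freemod C m) (j : 'I_m) : C := (v : {ffun 'I_m -> C}) j.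
have kapE x : x = \sum_l coord (vbasis {:S}) l x *: kap l.
  exact: coord_vbasis (memvf x).
have MP j a v w : M (a *: v + w) j = a *: M v j + M w j by rewrite /M !ffunE.
have Mi x j : M (i x) j = \sum_l coord (vbasis {:S}) l x *: M (i (kap l)) j.
  rewrite {1}[x]kapE linear_sum /M sum_ffunE; apply: eq_bigr => l _.
  by rewrite linearZ !ffunE.
have [Gj GjP] : exists Gj : 'I_m -> 'Hom(rpow T r, T), forall j, rhom (Gj j) /\
    forall t : {ffun 'I_r -> T}, Gj j t = \sum_l phi (M (i (kap l)) j) (t l).
  apply: (@fin_all_exists _ (fun=> 'Hom(rpow T r, T)) (fun j G => rhom G /\
    forall t : {ffun 'I_r -> T},
    G t = \sum_l phi (M (i (kap l)) j) (t l))) => j.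
  exact: rpow_couniv.
have [G [hG GE]] := rpow_univ (fun j => (GjP j).1).
have GE' (t : {ffun 'I_r -> T}) j :
    (G t : {ffun 'I_m -> T}) j = \sum_l phi (M (i (kap l)) j) (t l).
  by rewrite GE (GjP j).2.
have [ST [a [g [[ha hg a0 gT gE] aE]]]] := image_factor hG.
(* Left multiplication by the matrix of F, carried over to T. *)
pose FT (t : {ffun 'I_m -> T}) (q : 'I_n) : T :=
  \sum_j phi ((F (fbase C j) : {ffun 'I_n -> C}) q) (t j).
have FE (v : freemod C m) q : (F v : {ffun 'I_n -> C}) q =
    \sum_j (F (fbase C j) : {ffun 'I_n -> C}) q * M v j.
  rewrite {1}[v]freemod_sum linear_sum sum_ffunE; apply: eq_bigr => j _ /=.
  by rewrite hF ffunE.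
have FTE (v : freemod C m) x q :
    FT [ffun j => phi (M v j) x] q = phi ((F v : {ffun 'I_n -> C}) q) x.
  rewrite FE linear_sum sum_lfunE; apply: eq_bigr => j _.
  by rewrite ffunE /= phiM comp_lfunE.
have FTG (t : {ffun 'I_r -> T}) q : FT (G t) q = 0.
  rewrite /FT; under eq_bigr => j _ do rewrite GE' linear_sum.
  rewrite exchange_big big1 // => l _.
  have := FTE (i (kap l)) (t l) q.
  have : i (kap l) \in lker F by rewrite -iE limg_mem.
  rewrite memv_ker => /eqP ->; rewrite ffunE linear0 lfunE /= => FT0.
  apply: etrans FT0.
  by apply: eq_bigr => j _; rewrite ffunE.
have lift (xi : 'Hom(T, ST)) : rhom xi ->
    exists eta : 'Hom(T, rpow T r), rhom eta /\ (g \o eta)%VF = xi.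
  move=> hxi.
  have [c cE] : exists c : 'I_m -> C, forall j t,
      (a (xi t) : {ffun 'I_m -> T}) j = phi (c j) t.
    apply: (@fin_all_exists _ (fun=> C) (fun j c => forall t,
      (a (xi t) : {ffun 'I_m -> T}) j = phi c t)) => j.
    have [pr [hpr prE]] := rpow_proj T j.
    have /phiP[c cE] := rhom_comp hpr (rhom_comp ha hxi).
    by exists c => t; rewrite -cE !comp_lfunE prE.
  pose v : freemod C m := [ffun j => c j].
  have : v \in lker F.
    rewrite memv_ker; apply/eqP/ffunP => q; rewrite ffunE.
    apply: (lker_inj phi0); rewrite linear0; apply/lfunP=> t.
    rewrite lfunE -FTE.
    have : a (xi t) \in limg G by rewrite -aE limg_mem.
    case/limgP=> u uE; apply: etrans (FTG u q); rewrite -uE.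
    apply: eq_bigr => j _.
    by rewrite ffunE /M ffunE -cE.
  rewrite -iE => /limgP[x vE].
  have [eta [heta etaE]] := @rpow_univ k A T T r
    (fun l => coord (vbasis {:S}) l x *: \1%VF)
    (fun l => rhomZ (coord (vbasis {:S}) l x) (@rhom_id _ _ T)).
  exists eta; split=> //; apply/lfunP=> t; apply: (lker_inj a0).
  rewrite comp_lfunE -(comp_lfunE a g) gE; apply/ffunP => j.
  rewrite GE' cE; have -> : c j = M (i x) j by rewrite -vE /M ffunE.
  rewrite Mi linear_sum sum_lfunE; apply: eq_bigr => l _ /=.
  by rewrite etaE scale_lfunE id_lfunE !linearZ scale_lfunE.
have [s [hs gs]] := rigid_cover_split her eTT ha a0 hg gT lift.
(* c is the image of x under the section: its entries are the components of the
   composite of s with the map xi : T -> ST that belongs to x. *)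
pose R x (c : freemod C r) := exists xi : 'Hom(T, ST),
  (forall t j, (a (xi t) : {ffun 'I_m -> T}) j = phi (M (i x) j) t) /\
  (forall t l, phi ((c : {ffun 'I_r -> C}) l) t =
     (s (xi t) : {ffun 'I_r -> T}) l).
have Runiq x c c' : R x c -> R x c' -> c = c'.
  move=> [xi [xi1 xi2]] [xi' [xi1' xi2']]; apply/ffunP => l.
  apply: (lker_inj phi0); apply/lfunP=> t; rewrite xi2 xi2'.
  suff -> : xi t = xi' t by [].
  by apply: (lker_inj a0); apply/ffunP => j; rewrite xi1 xi1'.
have [x _|b x c x' c' [xi [xi1 xi2]] [xi' [xi1' xi2']]|X XP] :=
    @lin_choice k S (freemod C r) fullv R.
- have [u [hu uE]] := @rpow_univ k A T T m (fun j => phi (M (i x) j))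
    (fun j => hphi (M (i x) j)).
  have [eta [heta etaE]] := @rpow_univ k A T T r
    (fun l => coord (vbasis {:S}) l x *: \1%VF)
    (fun l => rhomZ (coord (vbasis {:S}) l x) (@rhom_id _ _ T)).
  have [|xi [hxi xiE]] := factor_mono ha hu a0.
    rewrite aE; apply/subvP => _ /limgP[t ->]; apply/limgP; exists (eta t).
    apply/ffunP => j; rewrite uE GE' Mi linear_sum sum_lfunE.
    apply: eq_bigr => l _ /=.
    by rewrite etaE scale_lfunE id_lfunE !linearZ scale_lfunE.
  have [c cE] : exists c : 'I_r -> C, forall l t,
      phi (c l) t = (s (xi t) : {ffun 'I_r -> T}) l.
    apply: (@fin_all_exists _ (fun=> C) (fun l c => forall t,
      phi c t = (s (xi t) : {ffun 'I_r -> T}) l)) => l.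
    have [pr [hpr prE]] := rpow_proj T l.
    have /phiP[c cE] := rhom_comp hpr (rhom_comp hs hxi).
    by exists c => t; rewrite -cE !comp_lfunE prE.
  exists [ffun l => c l], xi; split=> [t j|t l]; last by rewrite ffunE.
  by rewrite -(comp_lfunE a xi) xiE uE.
- exists (b *: xi + xi'); split=> [t j|t l].
    rewrite add_lfunE scale_lfunE linearP !ffunE xi1 xi1'.
    by rewrite linearP MP linearP add_lfunE scale_lfunE.
  rewrite add_lfunE scale_lfunE linearP !ffunE linearP.
  by rewrite add_lfunE scale_lfunE xi2 xi2'.
have hX : rhom X.
  move=> x b; apply: (@Runiq (x ** b)); first exact/XP/memvf.
  have [xi [xi1 xi2]] := XP x (memvf x).
  exists (xi \o phi b)%VF; split=> [t j|t l].
    by rewrite comp_lfunE xi1 hi /M ffunE /= phiM comp_lfunE.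
  by rewrite ffunE /= phiM !comp_lfunE xi2.
have [Y [hY YE]] := freemod_hom kap.
apply: (proj_retract (@freemod_projective k C r) hX hY).
apply/lfunP=> x; rewrite comp_lfunE YE id_lfunE; apply: (lker_inj i0).
apply/ffunP => j; apply: (lker_inj phi0); apply/lfunP=> t.
have [xi [xi1 xi2]] := XP x (memvf x).
rewrite -[X in _ = phi X t]/(M (i x) j) -xi1 -[xi t]id_lfunE -gs comp_lfunE.
rewrite -(comp_lfunE a g) gE GE' linear_sum sum_ffunE linear_sum sum_lfunE.
apply: eq_bigr => l _ /=.
by rewrite hi ffunE /= phiM comp_lfunE xi2.
Qed.

End Tilted.

Lemma tilted_gldim_le2 (k : fieldType) (C : falgType k) :
  tilted C -> gldim_le2 C.
Proof.
move=> [A [T [phi [[her [[pdT eT] _]] phi0 phiP _ phiM]]]].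
have eTT := Ext1_eq0_vanish pdT eT.
move=> P1 P0 S f i pP1 pP0 hf hi i0 iE.
have [m [c1 [hc1 c1T]]] := freemod_cover P1.
have [n [c0 [hc0 c0T]]] := freemod_cover P0.
have [s1 [hs1 s1E]] := pP1 _ _ _ _ hc1 (@rhom_id _ _ P1) c1T.
have [s0 [hs0 s0E]] := pP0 _ _ _ _ hc0 (@rhom_id _ _ P0) c0T.
have s0I x : (s0 x == 0) = (x == 0).
  apply/eqP/eqP => [s0x|->]; last by rewrite linear0.
  by rewrite -[x]id_lfunE -s0E comp_lfunE s0x linear0.
have hF : rhom (s0 \o (f \o c1))%VF by do !apply: rhom_comp.
have [S' [i' [hi' i'0 i'E]]] := sub_exists (submod_lker hF).
have pS' := ker_free_projective her eTT phi0 phiP phiM hF hi' i'0 i'E.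
have [|a [ha aE]] := factor_mono hi' (rhom_comp hs1 hi) i'0.
  rewrite i'E; apply/subvP => _ /limgP[x ->].
  rewrite memv_ker !comp_lfunE s0I -(comp_lfunE c1 s1) s1E id_lfunE.
  by rewrite -memv_ker -iE limg_mem.
have [|b [hb bE]] := factor_mono hi (rhom_comp hc1 hi') i0.
  rewrite iE; apply/subvP => _ /limgP[x ->].
  have : i' x \in lker (s0 \o (f \o c1))%VF by rewrite -i'E limg_mem.
  by rewrite !memv_ker !comp_lfunE s0I.
apply: (proj_retract pS' ha hb); apply/lfunP=> x; apply: (lker_inj i0).
rewrite comp_lfunE -(comp_lfunE i b) bE comp_lfunE -(comp_lfunE i' a) aE.
by rewrite comp_lfunE -(comp_lfunE c1 s1) s1E !id_lfunE.
Qed.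

(** * Minimal copresentations in global dimension two *)

Section SecondCosyzygy.
Variables (k : fieldType) (C : falgType k).
Implicit Types X Y Z P I S Q K M W J : rmodType C.

(** Dimension shifting: the obstruction to extending a map [X -> J] to an
    overmodule lies in an [Ext^3] with values in [M], computed by a projective
    resolution whose third syzygy vanishes. *)
Lemma second_cosyzygy_injective M I W I0 J (u : 'Hom(M, I)) (p : 'Hom(I, W))
    (j : 'Hom(W, I0)) (rho : 'Hom(I0, J)) :
    gldim_le2 C -> injective_mod I -> injective_mod I0 ->
    short_exact u p -> short_exact j rho -> injective_mod J.
Proof.
move=> gl iI iI0 [[hu hp] u0 uE pT] [[hj hrho] j0 jE rhoT] X Y g f hg hf g0.
have [n [pi [hpi piT]]] := freemod_cover Y.
have pP0 := @freemod_projective k C n.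
have [K1 [j1 [pi' [hj1 hpi' j10 pi'E j1S]]]] := pullback_mono hg hpi g0.
have [m [c1 [hc1 c1T]]] := freemod_cover K1.
have pP1 := @freemod_projective k C m.
have [K2 [k2 [hk2 k20 k2E]]] := sub_exists (submod_lker hc1).
have pK2 : projective K2.
  apply: (gl _ _ _ (j1 \o c1)%VF k2) => //; first exact: rhom_comp.
  rewrite k2E; apply/vspaceP => x; rewrite !memv_ker comp_lfunE.
  by rewrite -(inj_eq (lker_inj j10)) linear0.
have [F1 [hF1 F1E]] :=
  pP1 _ _ _ _ hrho (rhom_comp hf (rhom_comp hpi' hc1)) rhoT.
have [|G [hG GE]] := factor_mono hj (rhom_comp hF1 hk2) j0.
  apply/subvP => _ /limgP[x ->]; rewrite jE memv_ker -comp_lfunE comp_lfunA F1E.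
  rewrite !comp_lfunE; have : k2 x \in lker c1 by rewrite -k2E limg_mem.
  by rewrite memv_ker => /eqP ->; rewrite !linear0.
have [H [hH HE]] := pK2 _ _ _ _ hp hG pT.
have [H' [hH' H'E]] := iI _ _ _ _ hk2 hH k20.
have hjpH : rhom (j \o (p \o H'))%VF by do !apply: rhom_comp.
have [|F [hF FE]] := factor_epi hc1 (rhomB hF1 hjpH) c1T.
  apply/subvP => x; rewrite -k2E => /limgP[y ->]; rewrite memv_ker.
  rewrite add_lfunE opp_lfunE -(comp_lfunE F1 k2) -GE -HE -H'E.
  by rewrite !comp_lfunE subrr.
have rhoF x : rho (F x) = f (pi' x).
  have /limgP[y ->] : x \in limg c1 by rewrite c1T memvf.
  rewrite -(comp_lfunE F c1) FE add_lfunE opp_lfunE linearB /=.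
  rewrite -(comp_lfunE rho F1) F1E !comp_lfunE.
  have : j (p (H' y)) \in lker rho by rewrite -jE limg_mem.
  by rewrite memv_ker => /eqP ->; rewrite subr0.
have [F0 [hF0 F0E]] := iI0 _ _ _ _ hj1 hF j10.
have [|h [hh hE]] := factor_epi hpi (rhom_comp hrho hF0) piT.
  apply/subvP => x; rewrite !memv_ker => /eqP pix.
  have /limgP[y yE] : x \in limg j1 by rewrite j1S ?pix ?mem0v.
  rewrite yE comp_lfunE -(comp_lfunE F0 j1) F0E rhoF.
  move: pix; rewrite yE -(comp_lfunE pi j1) -pi'E comp_lfunE => gy.
  suff -> : pi' y = 0 by rewrite linear0.
  by apply: (lker_inj g0); rewrite gy linear0.
exists h; split=> //; apply/lfunP=> x.
have /limgP[z zE] : g x \in limg pi by rewrite piT memvf.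
have /limgP[y yE] : z \in limg j1 by rewrite j1S -?zE ?limg_mem.
 rewrite comp_lfunE zE -(comp_lfunE h pi) hE yE comp_lfunE.
rewrite -(comp_lfunE F0 j1) F0E rhoF; congr (f _); apply: (lker_inj g0).
by rewrite zE yE -(comp_lfunE pi j1) -pi'E comp_lfunE.
Qed.

Section Presentation.
Variables (M I W : rmodType C) (u : 'Hom(M, I)) (p : 'Hom(I, W)).
Variables (R1 R0 : rmodType (opalg C)).
Variables (r1 : 'Hom(R1, R0)) (r0 : 'Hom(R0, dual W)).
Hypotheses (gl : gldim_le2 C) (iI : injective_mod I) (se : short_exact u p).
Hypothesis mp : min_proj_presentation r1 r0.

(** The presentation of [D W] over the opposite algebra, dualised to an exact
    sequence [0 -> W -> D R0 -> D R1]. *)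
Lemma copresentation : exists j : 'Hom(W, Dm R0),
  [/\ rhom j, lker j = 0%VS & limg j = lker (tr r1 : 'Hom(Dm R0, Dm R1))].
Proof.
have [j [hj jE]] := flip_from (mpp_hom0 mp); exists j; split=> //.
  apply: lker0_of => w w' ww'; apply: dual_sep => phi.
  have /limgP[r ->] : phi \in limg r0 by rewrite (mpp_epi mp) memvf.
  by rewrite -!jE ww'.
apply/vspaceP => psi; rewrite memv_ker; apply/limgP/eqP => [[w ->]|psi0].
  apply: (@dev_ext k R1) => r; rewrite dev_tr jE dev0l.
  have : r1 r \in lker r0 by rewrite -(mpp_exact mp) limg_mem.
  by rewrite memv_ker => /eqP ->; rewrite dev0l.
have [|F FE] := @tr_factor k R0 'Hom(W, k^o) r0 psi.
  apply/subvP => r; rewrite -(mpp_exact mp) => /limgP[s ->].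
  by rewrite memv_ker -[psi _]/(dev psi (r1 s)) -dev_tr psi0 dev0l.
have [w wE] := ddual F; exists w; apply: (@dev_ext k R0) => r.
by rewrite jE -wE FE dev_tr.
Qed.

(** The image of [tr r1] is a second cosyzygy of [M], hence injective and a
    direct summand; dually [R1] splits along [r1], and minimality leaves no
    room for a kernel. *)
Lemma min_presentation_mono : lker r1 = 0%VS.
Proof.
have [j [hj j0 jE]] := copresentation.
have hrho : rhom (tr r1 : 'Hom(Dm R0, Dm R1)) := tr_rhom (mpp_hom1 mp).
have [J [b [rho' [[hb hrho' b0 rho'T rho'E] _]]]] := image_factor hrho.
have se' : short_exact j rho'.
  split=> //; rewrite jE -rho'E; apply/vspaceP => x.
  by rewrite !memv_ker comp_lfunE -[in RHS](inj_eq (lker_inj b0)) linear0.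
have iI0 := Dm_injective (mpp_proj0 mp).
have iJ := second_cosyzygy_injective gl iI iI0 se se'.
have [e' [he' e'E]] := iJ _ _ _ _ hb (@rhom_id _ _ J) b0.
have [e0 e0E] := tr_surj ((b \o e')%VF : 'Hom('Hom(R1, k^o), 'Hom(R1, k^o))).
have he0 : rhom e0.
  apply: rhom_tr; rewrite -e0E; exact: (rhom_comp hb he').
have r1e x : r1 (e0 x) = r1 x.
  apply: dual_sep => phi; rewrite -!(dev_tr r1) -(dev_tr e0) -e0E.
  congr (dev _ _); rewrite -rho'E !comp_lfunE -(comp_lfunE e' b) e'E.
  by rewrite id_lfunE.
have e0T : limg e0 = fullv.
  apply: (mpp_min1 mp); first exact: submod_limg.
  apply/vspaceP => x; rewrite memvf; apply/memv_addP.
  exists (e0 x); rewrite ?limg_mem //.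
  exists (x - e0 x); last by rewrite addrC subrK.
  by rewrite memv_ker linearB /= r1e subrr.
apply/eqP; rewrite -subv0 -(endo_onto_inj e0T); apply/subvP => x.
rewrite !memv_ker => /eqP r1x; apply/eqP/dual_sep => psi.
rewrite -dev_tr -e0E comp_lfunE dev0r.
have /limgP[phi ->] : e' psi \in limg rho' by rewrite rho'T memvf.
by rewrite -(comp_lfunE b rho') rho'E dev_tr r1x dev0r.
Qed.

End Presentation.

Lemma tr_lmul (x : C) :
  tr (reg_lmul (x : opalg C)) = DA_lmul x :> 'End('Hom(C, k^o)).
Proof.
apply/lfunP=> phi; apply: (@dev_ext k C) => y.
have E : @dev k C (DA_lmul x phi) y = @dev k C phi (y * x).
  exact: DA_lmulE x phi y.
apply: etrans (esym E); rewrite [LHS]dev_tr; congr (dev phi _).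
have lmulE (a b : opalg C) : amull a b = a * b by rewrite lfunE.
exact: lmulE x y.
Qed.

End SecondCosyzygy.

(** * The inverse translate of a cosyzygy as a second extension group *)

Section ExtComparison.
Variables (k : fieldType) (C : falgType k).
Implicit Types X Y Z P I S Q K M W J : rmodType C.

Section Cocycles.
Variables (P : nat -> rmodType C) (d : forall n, 'Hom(P n.+1, P n)).

Lemma cocycle0 n Y : @cocycle k C P d n Y 0.
Proof. by split; [apply: rhom0|rewrite comp_lfun0l]. Qed.

Lemma cocycle_lin n Y a (z z' : 'Hom(P n, Y)) :
  cocycle d z -> cocycle d z' -> cocycle d (a *: z + z').
Proof.
move=> [hz z0] [hz' z'0]; split; first by apply: rhomD => //; apply: rhomZ.
by rewrite comp_lfunDl -comp_lfunZl z0 z'0 scaler0 addr0.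
Qed.

Lemma cocycleB n Y (z z' : 'Hom(P n, Y)) :
  cocycle d z -> cocycle d z' -> cocycle d (z - z').
Proof.
by move=> zC z'C; rewrite addrC -scaleN1r; apply: cocycle_lin.
Qed.

Lemma cocycle_scal n X (x : X) (phi : 'Hom(P n, regmod C)) :
  cocycle d phi -> cocycle d (scal x phi).
Proof.
move=> [hphi phid]; split; first exact: rhom_scal.
by rewrite scal_comp phid; apply/lfunP=> p; rewrite scalE !lfunE linear0.
Qed.

Lemma cocycle_lmul n (c : C) (phi : 'Hom(P n, regmod C)) :
  cocycle d phi -> cocycle d (reg_lmul c \o phi)%VF.
Proof.
move=> [hphi phid]; split; first exact: rhom_comp (reg_lmul_rhom c) hphi.
by rewrite -comp_lfunA phid comp_lfun0r.
Qed.

Lemma cocycle_chain n Y (z : 'Hom(P n, Y)) (h : forall n, 'End(P n)) :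
    (forall n, rhom (h n)) ->
    (forall n, (d n \o h n.+1)%VF = (h n \o d n)%VF) ->
  cocycle d z -> cocycle d (z \o h n)%VF.
Proof.
move=> hh hc [hz zd]; split; first exact: rhom_comp.
by rewrite -comp_lfunA -hc comp_lfunA zd comp_lfun0l.
Qed.

Lemma cocycle_coboundary X (eps : 'Hom(P 0%N, X)) n Y (g : 'Hom(P n, Y)) :
  proj_resolution d eps -> rhom g -> cocycle d (g \o d n)%VF.
Proof.
move=> res hg; split; first exact: (rhom_comp hg (res_homd res (n:=n))).
apply/lfunP=> x; rewrite !comp_lfunE lfunE.
have : d n.+1 x \in lker (d n) by rewrite -(res_exact res) limg_mem.
by rewrite memv_ker => /eqP ->; rewrite linear0.
Qed.

End Cocycles.

(** If the second syzygy of the resolved module is projective, a dual basis of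
    it makes every 2-cocycle with values in [M] a sum of products of elements
    of [M] with 2-cocycles valued in the algebra. *)
Lemma cocycle_dual_basis X (P : nat -> rmodType C)
    (d : forall n, 'Hom(P n.+1, P n)) (eps : 'Hom(P 0%N, X)) :
    gldim_le2 C -> proj_resolution d eps ->
  exists n (u : 'I_n -> P 2%N) (chi : 'I_n -> 'Hom(P 2%N, regmod C)),
    (forall i, cocycle d (chi i)) /\
    forall M (z : 'Hom(P 2%N, M)), cocycle d z ->
      z = \sum_i scal (z (u i)) (chi i).
Proof.
move=> gl res; have hd n : rhom (d n) by exact: (res_homd res).
have pP n : projective (P n) by exact: (res_proj res).
have [S [i [r [[hi hr i0 rT rE] iE]]]] := image_factor (hd 1%N).
have pS : projective S.
  apply: (gl _ _ _ _ _ (pP 1%N) (pP 0%N) (hd 0%N) hi i0).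
  by rewrite iE (res_exact res).
have rd x : r (d 2%N x) = 0.
  apply: (lker_inj i0); rewrite -(comp_lfunE i r) rE linear0.
  by apply/eqP; rewrite -memv_ker -(res_exact res) limg_mem.
have [n [s [xi [hxi sE]]]] := proj_dual_basis pS.
have [u uE] : exists u : 'I_n -> P 2%N, forall l, r (u l) = s l.
  apply: (@fin_all_exists _ (fun=> P 2%N) (fun l x => r x = s l)) => l.
  have /limgP[x ->] : s l \in limg r by rewrite rT memvf.
  by exists x.
exists n, u, (fun l => xi l \o r)%VF; split.
  move=> l; split; first exact: rhom_comp.
  by apply/lfunP=> x; rewrite !comp_lfunE rd linear0 lfunE.
move=> M z [hz zd]; have [|z' [hz' z'E]] := factor_epi hr hz rT.
  apply/subvP => x; rewrite memv_ker => /eqP rx.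
  have : x \in limg (d 2%N).
    by rewrite (res_exact res) memv_ker -rE comp_lfunE rx linear0.
  by case/limgP=> y ->; rewrite memv_ker -comp_lfunE zd lfunE.
apply/lfunP=> p; rewrite sum_lfunE -z'E comp_lfunE {1}[r p]sE linear_sum.
by apply: eq_bigr => l _; rewrite /= hz' scalE !comp_lfunE uE.
Qed.

Section Ext2.
Variables (P : nat -> rmodType C) (d : forall n, 'Hom(P n.+1, P n)).
Variables (eps : 'Hom(P 0%N, DA C)) (M Y : rmodType C).

(** [Y] is [Ext^2(D C, M)], computed from a resolution [P] of [D C]: the map
    [Gam] is onto on cocycles, with the coboundaries as kernel, and [C] acts
    on the right through lifts of its left action on [D C]. *)
Definition ext2_quotient (Gam : 'Hom('Hom(P 2%N, M), Y)) : Prop :=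
  [/\ forall y, exists z, cocycle d z /\ Gam z = y,
      forall z, cocycle d z -> (Gam z = 0 <-> coboundary d z) &
      forall (x : C) (h : forall n, 'End(P n)),
        (forall n, rhom (h n)) ->
        (forall n, (d n \o h n.+1)%VF = (h n \o d n)%VF) ->
        (eps \o h 0%N)%VF = (DA_lmul x \o eps)%VF ->
        forall z, cocycle d z -> Gam (z \o h 2%N)%VF = Gam z ** x].

End Ext2.

Section ExtTranslate.
Variables (M I W Y : rmodType C) (u : 'Hom(M, I)) (p : 'Hom(I, W)).
Variables (R1 R0 : rmodType (opalg C)).
Variables (r1 : 'Hom(R1, R0)) (r0 : 'Hom(R0, dual W)).
Variable q : 'Hom('Hom(R1, regmod (opalg C)), Y).
Hypotheses (gl : gldim_le2 C) (iI : injective_mod I) (se : short_exact u p).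
Hypothesis mp : min_proj_presentation r1 r0.
Hypothesis q_onto : forall y, exists f, rhom f /\ q f = y.
Hypothesis q_ker : forall f, rhom f -> (q f = 0 <->
  exists g : 'Hom(R0, regmod (opalg C)), rhom g /\ f = (g \o r1)%VF).
Hypothesis q_act : forall (a : C) f, rhom f ->
  q (reg_lmul (a : opalg C) \o f)%VF = q f ** a.

Variables (P : nat -> rmodType C) (d : forall n, 'Hom(P n.+1, P n)).
Variable eps : 'Hom(P 0%N, DA C).
Hypothesis res : proj_resolution d eps.

Variable j : 'Hom(W, Dm R0).
Hypotheses (hj : rhom j) (j0 : lker j = 0%VS).
Hypothesis jE : limg j = lker (tr r1 : 'Hom(Dm R0, Dm R1)).

(** The connecting data between the resolution of [D C] and the injective
    copresentation [M -> I -> D R0 -> D R1]: a ladder whose last rung is a map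
    [D C -> D R1], written as the transpose of [c], and whose first rung is the
    2-cochain [z]. *)
Definition ladder (y : Y) (z : 'Hom(P 2%N, M)) : Prop :=
  exists (c : 'Hom(R1, regmod (opalg C))) (b : 'Hom(P 0%N, Dm R0))
    (a : 'Hom(P 1%N, I)),
  [/\ rhom c /\ q c = y, rhom b /\ rhom a, (u \o z)%VF = (a \o d 1%N)%VF,
      (j \o (p \o a))%VF = (b \o d 0%N)%VF &
      forall x, tr r1 (b x) = tr c (eps x)].

Let hu : rhom u. Proof. by case: se => -[]. Qed.
Let hp : rhom p. Proof. by case: se => -[]. Qed.
Let u0 : lker u = 0%VS. Proof. by case: se. Qed.
Let uE : limg u = lker p. Proof. by case: se. Qed.
Let pT : limg p = fullv. Proof. by case: se. Qed.
Let pu x : p (u x) = 0.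
Proof. by apply/eqP; rewrite -memv_ker -uE limg_mem. Qed.
Let rhoj w : tr r1 (j w) = 0.
Proof. by apply/eqP; rewrite -memv_ker -jE limg_mem. Qed.
Let hrho : rhom (tr r1 : 'Hom(Dm R0, Dm R1)) := tr_rhom (mpp_hom1 mp).
(* The bound on the global dimension enters the ladder only through rhoT. *)
Let rhoT : limg (tr r1 : 'Hom(Dm R0, Dm R1)) = fullv.
Proof.
apply/limg_fullP => psi; apply: tr_factor.
by rewrite (min_presentation_mono gl iI se mp) sub0v.
Qed.
Let dd n x : d n (d n.+1 x) = 0.
Proof. by apply/eqP; rewrite -memv_ker -(res_exact res) limg_mem. Qed.
Let epsd x : eps (d 0%N x) = 0.
Proof. by apply/eqP; rewrite -memv_ker -(res_exact0 res) limg_mem. Qed.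
Let htr (c : 'Hom(R1, regmod (opalg C))) :
  rhom c -> rhom (tr c : 'Hom(DA C, Dm R1)).
Proof. exact: tr_rhom. Qed.

Lemma ladder_lin a y z y' z' :
  ladder y z -> ladder y' z' -> ladder (a *: y + y') (a *: z + z').
Proof.
move=> [c [b [e [[hc cE] [hb he] e1 e2 e3]]]].
move=> [c' [b' [e' [[hc' cE'] [hb' he'] e1' e2' e3']]]].
exists (a *: c + c'), (a *: b + b'), (a *: e + e'); split.
- by split; [apply: rhomD => //; apply: rhomZ|rewrite linearP /= cE cE'].
- by split; apply: rhomD => //; apply: rhomZ.
- apply/lfunP=> x; rewrite !(comp_lfunE, add_lfunE, scale_lfunE) linearP /=.
  by rewrite (comp_lfun_ext e1) (comp_lfun_ext e1').
- apply/lfunP=> x; rewrite !(comp_lfunE, add_lfunE, scale_lfunE) !linearP /=.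
  rewrite -!(comp_lfunE p) (comp_lfun_ext e2) (comp_lfun_ext e2') //.
- move=> x; apply: (@dev_ext k R1) => r.
  rewrite !dev_tr !(add_lfunE, scale_lfunE) devPl devPr -!dev_tr e3 e3'.
  by rewrite !dev_tr.
Qed.

Lemma ladder_down y : exists z, cocycle d z /\ ladder y z.
Proof.
have [c [hc cE]] := q_onto y.
have [b [hb bE]] :=
  res_proj res (n:=0%N) hrho (rhom_comp (htr hc) (res_home res)) rhoT.
have bE' x : tr r1 (b x) = tr c (eps x) by rewrite -!comp_lfunE bE.
have hd n : rhom (d n) by exact: (res_homd res).
have [|w [hw wE]] := factor_mono hj (rhom_comp hb (hd 0%N)) j0.
  apply/subvP => _ /limgP[x ->]; rewrite jE memv_ker comp_lfunE bE' epsd.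
  by rewrite linear0.
have [a [ha aE]] := res_proj res (n:=1%N) hp hw pT.
have wd x : w (d 1%N x) = 0.
  by apply: (lker_inj j0); rewrite -(comp_lfunE j w) wE comp_lfunE dd !linear0.
have [|z [hz zE]] := factor_mono hu (rhom_comp ha (hd 1%N)) u0.
  apply/subvP => _ /limgP[x ->]; rewrite uE memv_ker comp_lfunE.
  by rewrite -(comp_lfunE p a) aE wd.
exists z; split; last by exists c, b, a; split; rewrite ?aE.
split=> //; apply/lfunP=> x; apply: (lker_inj u0).
by rewrite comp_lfunE -(comp_lfunE u z) zE comp_lfunE dd lfunE /= !linear0.
Qed.

Lemma ladder_up z : cocycle d z -> exists y, ladder y z.
Proof.
move=> [hz zd]; have hd n : rhom (d n) by exact: (res_homd res).
have [|a [ha aE]] := inj_ext iI (hd 1%N) (rhom_comp hu hz).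
  apply/subvP => x; rewrite -(res_exact res) => /limgP[y ->].
  by rewrite memv_ker comp_lfunE -(comp_lfunE z) zd lfunE linear0.
have iR0 := Dm_injective (mpp_proj0 mp).
have [|b [hb bE]] := inj_ext iR0 (hd 0%N) (rhom_comp hj (rhom_comp hp ha)).
  apply/subvP => x; rewrite -(res_exact res) => /limgP[y ->].
  by rewrite memv_ker !comp_lfunE -(comp_lfunE a) aE comp_lfunE pu linear0.
have [|t [ht tE]] :=
    factor_epi (res_home res) (rhom_comp hrho hb) (res_epi res).
  apply/subvP => x; rewrite -(res_exact0 res) => /limgP[y ->].
  by rewrite memv_ker comp_lfunE -(comp_lfunE b) bE comp_lfunE rhoj.
have [c cE] := tr_surj (t : 'Hom('Hom(C, k^o), 'Hom(R1, k^o))).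
have hc : @rhom k (opalg C) R1 (regmod (opalg C)) c.
  by apply: rhom_tr; rewrite -cE; exact: ht.
exists (q c), c, b, a; split=> // x.
by rewrite -cE -(comp_lfunE _ b) -tE comp_lfunE.
Qed.

Lemma ladder_coboundary y z : ladder y z -> coboundary d z -> y = 0.
Proof.
move=> [c [b [a [[hc <-] [hb ha] e1 e2 e3]]]] [z' [hz' zE]].
have hd n : rhom (d n) by exact: (res_homd res).
have [|a' [ha' a'E]] := inj_ext iI (hd 0%N) (rhomB ha (rhom_comp hu hz')).
  apply/subvP => x; rewrite -(res_exact res) => /limgP[t ->].
  rewrite memv_ker add_lfunE opp_lfunE -!(comp_lfunE _ (d 1%N)) -e1 zE.
  by rewrite comp_lfunA subrr.
have hjpa : rhom (j \o (p \o a'))%VF by do !apply: rhom_comp.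
have [|b' [hb' b'E]] := factor_epi (res_home res) (rhomB hb hjpa) (res_epi res).
  apply/subvP => x; rewrite -(res_exact0 res) => /limgP[t ->].
  rewrite memv_ker add_lfunE opp_lfunE -(comp_lfunE b) -e2 !comp_lfunE.
  rewrite -(comp_lfunE a' (d 0%N)) a'E add_lfunE opp_lfunE comp_lfunE.
  by rewrite !linearB /= pu linear0 opprK addr0 subrr.
have [c' c'E] := tr_surj (b' : 'Hom('Hom(C, k^o), 'Hom(R0, k^o))).
have hc' : @rhom k (opalg C) R0 (regmod (opalg C)) c'.
  by apply: rhom_tr; rewrite -c'E; exact: hb'.
apply/(q_ker hc); exists c'; split=> //; apply/lfunP=> r.
apply: (@dual_sep k C) => phi; rewrite -dev_tr.
have /limgP[x ->] : phi \in limg eps by rewrite (res_epi res) memvf.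
rewrite -e3 comp_lfunE -(dev_tr c') -c'E -(comp_lfunE b' eps) b'E.
rewrite add_lfunE opp_lfunE -dev_tr; congr (dev _ _).
by rewrite linearB /= !comp_lfunE rhoj subr0.
Qed.

Lemma ladder_zero z : rhom z -> ladder 0 z -> coboundary d z.
Proof.
move=> hz [c [b [a [[hc cE] [hb ha] e1 e2 e3]]]].
have hd n : rhom (d n) by exact: (res_homd res).
have [g [hg gE]] := (q_ker hc).1 cE.
have hge : rhom ((tr g : 'Hom(DA C, Dm R0)) \o eps)%VF.
  by apply: rhom_comp (res_home res); apply: (tr_rhom hg).
have [|w [hw wE]] := factor_mono hj (rhomB hb hge) j0.
  apply/subvP => _ /limgP[x ->]; rewrite jE memv_ker add_lfunE opp_lfunE.
  apply/eqP/(@dev_ext k R1) => r; rewrite dev0l dev_tr /dev.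
  rewrite add_lfunE opp_lfunE -!/(dev _ _) -(dev_tr r1) e3 gE !comp_lfunE.
  by rewrite !dev_tr comp_lfunE subrr.
have [a' [ha' a'E]] := res_proj res (n:=0%N) hp hw pT.
have [|z' [hz' z'E]] := factor_mono hu (rhomB ha (rhom_comp ha' (hd 0%N))) u0.
  apply/subvP => _ /limgP[x ->]; rewrite uE memv_ker; apply/eqP/(lker_inj j0).
  rewrite add_lfunE opp_lfunE !linearB /= linear0.
  have := congr1 (fun t : 'Hom(P 1%N, Dm R0) => t x) e2.
  rewrite /= !comp_lfunE => ->.
  rewrite -(comp_lfunE p a') a'E -(comp_lfunE j w) wE add_lfunE opp_lfunE.
  by rewrite opprB addrC subrK comp_lfunE epsd linear0.
exists z'; split=> //; apply/lfunP=> x; apply: (lker_inj u0).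
rewrite -(comp_lfunE u z) e1 !comp_lfunE -(comp_lfunE u z') z'E.
by rewrite add_lfunE opp_lfunE comp_lfunE dd linear0 subr0.
Qed.

Lemma ladder_act (x : C) (h : forall n, 'End(P n)) y z :
    (forall n, rhom (h n)) ->
    (forall n, (d n \o h n.+1)%VF = (h n \o d n)%VF) ->
    (eps \o h 0%N)%VF = (DA_lmul x \o eps)%VF ->
  ladder y z -> ladder (y ** x) (z \o h 2%N)%VF.
Proof.
move=> hh hd he [c [b [a [[hc <-] [hb ha] e1 e2 e3]]]].
exists (reg_lmul (x : opalg C) \o c)%VF, (b \o h 0%N)%VF, (a \o h 1%N)%VF.
split.
- by split; [apply: rhom_comp => //; apply: reg_lmul_rhom|rewrite q_act].
- by split; apply: rhom_comp.
- by rewrite comp_lfunA e1 -!comp_lfunA hd.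
- by rewrite -[RHS]comp_lfunA -hd [RHS]comp_lfunA -e2 !comp_lfunA.
move=> t; rewrite comp_lfunE e3 -(comp_lfunE eps) he comp_lfunE.
apply: (@dev_ext k R1) => r; rewrite !dev_tr comp_lfunE.
by rewrite -(dev_tr (reg_lmul (x : opalg C))) tr_lmul.
Qed.

(** The ladders identify [Y], which is [tau^-1] of the cosyzygy [W], with
    [Ext^2(D C, M)]. *)
Lemma ladder_ext2 : exists Gam, @ext2_quotient P d eps M Y Gam.
Proof.
have uniq y y' z : ladder y z -> ladder y' z -> y = y'.
  move=> l l'; apply/eqP; rewrite -subr_eq0; apply/eqP.
  have := ladder_lin (-1) l' l; rewrite !scaleN1r addNr addrC => l0.
  apply: (ladder_coboundary l0); exists 0.
  by split; [apply: rhom0|rewrite comp_lfun0l].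
have [||U UP] := @subspace_exists k _
    (fun z : 'Hom(P 2%N, M) => cocycle d z).
- exact: cocycle0.
- by move=> a z z'; apply: cocycle_lin.
have [z /UP/ladder_up//|a z y z' y'|Gam GamP] :=
    @lin_choice k _ Y U (fun z y => ladder y z).
  exact: ladder_lin.
have GamP' z : cocycle d z -> ladder (Gam z) z by move/UP/GamP.
exists Gam; split.
- move=> y; have [z [zc lz]] := ladder_down y; exists z; split=> //.
  by apply: (uniq _ _ z) => //; apply: GamP'.
- move=> z zc; have lz := GamP' z zc.
  split=> [G0|]; last exact: ladder_coboundary.
  by apply: ladder_zero; [case: zc|rewrite -G0].
- move=> x h hh hd he z [hz zd].
  have zc' : cocycle d (z \o h 2%N)%VF by apply: cocycle_chain.
  apply: (uniq _ _ (z \o h 2%N)%VF); first exact: GamP'.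
  by apply: ladder_act => //; apply: GamP'.
Qed.

End ExtTranslate.

Lemma tau_inv_cosyzygy_ext2 M W Y (P : nat -> rmodType C)
    (d : forall n, 'Hom(P n.+1, P n)) (eps : 'Hom(P 0%N, DA C)) :
    gldim_le2 C -> is_cosyzygy M W -> is_tau_inv W Y -> proj_resolution d eps ->
  exists Gam, @ext2_quotient P d eps M Y Gam.
Proof.
move=> gl [I [u [p [iI se _]]]].
move=> [N [[R1 [R0 [r1 [r0 [q [mp qS qK qA]]]]]]]] rY res.
have [f [hf f0 fT]] := rY.
have [g [hg fg gf]] := iso_inv hf f0 fT.
have g0 y : g y = 0 <-> y = 0.
  split=> [gy|->]; last by rewrite linear0.
  by rewrite -[y]id_lfunE -fg comp_lfunE gy linear0.
have [j [hj j0 jE]] := copresentation mp.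
have qS' y : exists c, rhom c /\ (g \o q)%VF c = y.
  have [c [hc cE]] := qS (f y); exists c; split=> //.
  by rewrite comp_lfunE cE -(comp_lfunE g f) gf id_lfunE.
have qK' c : rhom c -> ((g \o q)%VF c = 0 <->
    exists t : 'Hom(R0, regmod (opalg C)), rhom t /\ c = (t \o r1)%VF).
  by move=> hc; rewrite comp_lfunE g0; apply: qK.
have qA' (a : C) c : rhom c ->
    (g \o q)%VF (reg_lmul (a : opalg C) \o c)%VF = (g \o q)%VF c ** a.
  by move=> hc; rewrite !comp_lfunE qA // -hg.
exact: (ladder_ext2 gl iI se mp qS' qK' qA' res hj j0 jE).
Qed.

Lemma DA_lmul_rhom (x : C) : rhom (DA_lmul x).
Proof.
rewrite -tr_lmul.
exact: (@tr_rhom k (opalg C) (regmod (opalg C)) (regmod (opalg C)) _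
  (reg_lmul_rhom (x : opalg C))).
Qed.

Lemma chain_lift (P : nat -> rmodType C) (d : forall n, 'Hom(P n.+1, P n))
    (eps : 'Hom(P 0%N, DA C)) (x : C) : proj_resolution d eps ->
  exists h : forall n, 'End(P n),
    [/\ forall n, rhom (h n),
        forall n, (d n \o h n.+1)%VF = (h n \o d n)%VF &
        (eps \o h 0%N)%VF = (DA_lmul x \o eps)%VF].
Proof.
move=> res; have hd n : rhom (d n) by exact: (res_homd res).
pose good n (s : 'End(P n) * 'End(P n.+1)) :=
  [/\ rhom s.1, rhom s.2 & (d n \o s.2)%VF = (s.1 \o d n)%VF].
have step n (s : {s | good n s}) :
    {t : {t | good n.+1 t} | (sval t).1 = (sval s).2}.
  apply: constructive_indefinite_description; case: s => -[s1 s2] [/= h1 h2 E].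
  have [|t [ht tE]] := proj_lift (res_proj res (n:=n.+2)) (hd n.+1)
      (rhom_comp h2 (hd n.+1)).
    apply/subvP => _ /limgP[y ->]; rewrite (res_exact res) memv_ker.
    rewrite -comp_lfunE comp_lfunA E !comp_lfunE.
    have : d n.+1 y \in lker (d n) by rewrite -(res_exact res) limg_mem.
    by rewrite memv_ker => /eqP ->; rewrite linear0.
  have gt : good n.+1 (s2, t) by [].
  by exists (exist _ _ gt).
have [h0 [hh0 h0E]] := res_proj res (n:=0%N) (res_home res)
  (rhom_comp (DA_lmul_rhom x) (res_home res)) (res_epi res).
have [|h1 [hh1 h1E]] := proj_lift (res_proj res (n:=1%N)) (hd 0%N)
    (rhom_comp hh0 (hd 0%N)).
  apply/subvP => _ /limgP[y ->]; rewrite (res_exact0 res) memv_ker.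
  rewrite -comp_lfunE comp_lfunA h0E !comp_lfunE.
  have : d 0%N y \in lker eps by rewrite -(res_exact0 res) limg_mem.
  by rewrite memv_ker => /eqP ->; rewrite linear0.
have g0 : good 0%N (h0, h1) by [].
(* Two consecutive maps are carried along, as the next one depends on both. *)
pose s := nat_rect (fun n => {s | good n s}) (exist _ _ g0)
  (fun n s => sval (step n s)).
have sE n : (sval (s n.+1)).1 = (sval (s n)).2 := svalP (step n (s n)).
exists (fun n => (sval (s n)).1); split=> //.
  by move=> n; case: (svalP (s n)).
by move=> n; rewrite sE; case: (svalP (s n)).
Qed.

End ExtComparison.

(** * Extensions over the trivial extension algebra *)

Section Balanced.
Variables (k : fieldType) (C : falgType k) (E : bimodType C).
Implicit Types M X : rmodType C.

(** A homomorphism [M (x)_C E -> X], without the tensor product. *)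
Definition balanced M X (beta : 'Hom(M, 'Hom(E, X))) : Prop :=
  (forall m c e, beta (m ** c) e = beta m (lact c e)) /\
  (forall m e c, beta m (e ** c) = beta m e ** c).

Lemma lact0r (c : C) : lact c (0 : E) = 0.
Proof.
by have := lact_linearr c (-1) 0 (0 : E); rewrite scaler0 addr0 scaleN1r addNr.
Qed.

Lemma lact0l (e : E) : lact (0 : C) e = 0.
Proof.
by have := lact_linearl e (-1) 0 0; rewrite scaler0 addr0 scaleN1r addNr.
Qed.

Lemma trivext_mulE (c c' : C) (e e' : E) :
  ((c, e) : trivext E) * ((c', e') : trivext E) =
  (c * c', lact c e' + e ** c') :> trivext E.
Proof. by []. Qed.

Lemma ract0r M (x : M) : x ** (0 : C) = 0.
Proof. exact: (linear0 (@ract k C M x)). Qed.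

Section BalancedExtension.
Variables (M X : rmodType C) (beta : 'Hom(M, 'Hom(E, X))).
Hypothesis bal : balanced beta.

Definition balext_act (v : (M * X)%type) (b : trivext E) : (M * X)%type :=
  (v.1 ** b.1, v.2 ** b.1 + beta v.1 b.2).
Fact balext_linearr v : linear (balext_act v).
Proof.
move=> a b b'; congr pair; rewrite /= !linearP //=.
by rewrite scalerDr addrACA.
Qed.
Fact balext_linearl b : linear (fun v => balext_act v b).
Proof.
move=> a v v'; congr pair; rewrite /= ?ractDl ?ractZl //.
by rewrite linearP /= add_lfunE scale_lfunE scalerDr addrACA.
Qed.
Fact balext_act1 v : balext_act v 1 = v.
Proof. by case: v => m x; rewrite /balext_act /= !ract1 linear0 addr0. Qed.
Fact balext_actM v b b' :
  balext_act v (b * b') = balext_act (balext_act v b) b'.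
Proof.
case: bal => bal1 bal2; congr pair; rewrite /= ractM // linearD /= bal2 -bal1.
by rewrite ractDl addrAC addrA addrAC.
Qed.
(** The extension of [M] by [X] that is split over [C] and on which [E] acts by
    [beta]. *)
Definition balext : rmodType (trivext E) :=
  RMod balext_linearr balext_linearl balext_act1 balext_actM.

End BalancedExtension.

(** A retraction [r] of [balext] onto [X] satisfies
    [beta m e = r ((m, 0) e) = r (m, 0) e], and [E] annihilates [X]. *)
Lemma ext_vanish_balanced0 M X (beta : 'Hom(M, 'Hom(E, X))) :
  balanced beta -> ext_vanish (inflate E M) (inflate E X) -> beta = 0.
Proof.
move=> bal ext.
have [|i iE] := @lfun_exists k (inflate E X) (balext bal)
    (fun x : X => ((0 : M), x)).
  by move=> a x y; congr pair; rewrite /= scaler0 addr0.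
have [|p pE] := @lfun_exists k (balext bal) (inflate E M)
    (fun v : (M * X)%type => v.1).
  by [].
have se : short_exact i p.
  split.
  - split=> [x b|v b]; last by rewrite !pE.
    by rewrite !iE; congr pair; rewrite /= ?ract0l // linear0 lfunE /= addr0.
  - by apply: lker0_of => x y; rewrite !iE => -[].
  - apply/vspaceP => -[m x]; rewrite memv_ker pE /=.
    apply/limgP/eqP => [[y]|->]; first by rewrite iE => -[->].
    by exists x; rewrite iE.
  - by apply/limg_fullP => m; exists (m, 0); rewrite pE.
have [r [hr rE]] := ext _ _ _ _ _ se (@rhom_id _ _ (inflate E X)).
apply/lfunP=> m; apply/lfunP=> e; rewrite !lfunE /=.
have ri x : r (0, x) = x by rewrite -[RHS]id_lfunE -rE comp_lfunE iE.
have := hr (m, 0) (0, e).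
have -> : ((m, 0) : balext bal) ** ((0, e) : trivext E) = (0, beta m e).
  by congr pair; rewrite /= ?ract0r ?add0r.
by rewrite ri => ->; exact: ract0r.
Qed.

Section Restriction.
Variable V : rmodType (trivext E).

Definition restr_act (v : V) (c : C) : V := v ** ((c, 0) : trivext E).
Fact restr_linearr v : linear (restr_act v).
Proof.
move=> a c c'; rewrite /restr_act -linearP; congr (_ ** _).
by congr pair; rewrite /= scaler0 addr0.
Qed.
Fact restr_linearl c : linear (fun v => restr_act v c).
Proof. by move=> a v v'; rewrite /restr_act ractDl ractZl. Qed.
Fact restr_act1 v : restr_act v 1 = v.
Proof. exact: ract1. Qed.
Fact restr_actM v c c' : restr_act v (c * c') = restr_act (restr_act v c) c'.
Proof.
rewrite /restr_act -ractM trivext_mulE; congr (_ ** _); congr pair.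
by rewrite /= lact0r ract0l addr0.
Qed.
Definition restr : rmodType C :=
  RMod restr_linearr restr_linearl restr_act1 restr_actM.

Lemma restr_split (v : V) (c : C) (e : E) :
  v ** ((c, e) : trivext E) =
  v ** ((c, 0) : trivext E) + v ** ((0, e) : trivext E).
Proof.
rewrite -linearD; congr (_ ** _).
by congr pair; rewrite /= ?addr0 ?add0r.
Qed.

End Restriction.

(** In an extension [S -> V -> M], multiplying lifts of elements of [M] by [E]
    lands in [S]; followed by a map [S -> Z] this is a balanced map
    [M x E -> Z].  If it vanishes, then a [C]-linear extension [V -> Z] of
    [S -> Z] kills [V E] as [S -> Z] does, and is linear over [trivext E]. *)
Lemma restr_ext_vanish M (Z : rmodType (trivext E)) :
    (forall (z : Z) e, z ** ((0, e) : trivext E) = 0) ->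
    ext_vanish M (restr Z) ->
    (forall beta : 'Hom(M, 'Hom(E, restr Z)), balanced beta -> beta = 0) ->
  ext_vanish (inflate E M) Z.
Proof.
move=> ZE ext bal0 S V i p th [[hi hp] i0 iE pT] hth.
have iI := lker_inj i0.
have pE0 v e : exists s, i s = v ** ((0, e) : trivext E).
  have : v ** ((0, e) : trivext E) \in limg i.
    by rewrite iE memv_ker hp; apply/eqP/ract0r.
  by case/limgP=> s ->; exists s.
have [m _|a m b m' b' [v [<- vb]] [v' [<- vb']]|beta bP] :=
    @lin_choice k M 'Hom(E, restr Z) fullv (fun m b => exists v, p v = m /\
    forall e s, i s = v ** ((0, e) : trivext E) -> b e = th s).
- have /limgP[v mE] : m \in limg p by rewrite pT memvf.
  have [e _|a e z e' z' [s [sE ->]] [s' [sE' ->]]|b bE] :=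
      @lin_choice k E (restr Z) fullv (fun e z => exists s,
      i s = v ** ((0, e) : trivext E) /\ z = th s).
  + by have [s sE] := pE0 v e; exists (th s), s.
  + exists (a *: s + s'); split; last by rewrite linearP.
    rewrite linearP /= sE sE' -linearP; congr (_ ** _).
    by congr pair; rewrite /= scaler0 addr0.
  exists b, v; split=> // e s sE; have [s' [sE' ->]] := bE e (memvf e).
  by congr (th _); apply: iI; rewrite sE.
- exists (a *: v + v'); split=> [|e s sE]; first by rewrite linearP.
  have [t tE] := pE0 v e; have [t' tE'] := pE0 v' e.
  have -> : s = a *: t + t'.
    by apply: iI; rewrite sE linearP /= tE tE' ractDl ractZl.
  by rewrite add_lfunE scale_lfunE (vb _ t) // (vb' _ t') // linearP.
have betaE v e s : i s = v ** ((0, e) : trivext E) -> beta (p v) e = th s.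
  move=> sE; have [v0 [pv0 v0E]] := bP (p v) (memvf _).
  have [s0 s0E] := pE0 v0 e; rewrite (v0E e s0) //.
  have : v - v0 \in limg i by rewrite iE memv_ker linearB /= pv0 subrr.
  case/limgP=> t tE; have -> : s = s0 + t ** ((0, e) : trivext E).
    by apply: iI; rewrite linearD /= hi -tE sE s0E ractBl addrC subrK.
  by rewrite linearD /= hth ZE addr0.
have bal : balanced beta.
  split=> [m c e|m e c]; have /limgP[v ->] : m \in limg p by rewrite pT memvf.
    have [s sE] := pE0 v (lact c e).
    rewrite (betaE _ _ _ sE).
    have -> : @ract k C M (p v) c = p (v ** ((c, 0) : trivext E)).
      by rewrite hp.
    apply: betaE; rewrite sE -ractM trivext_mulE; congr (_ ** _); congr pair.
      by rewrite mulr0.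
    by rewrite ract0r addr0.
  have [s sE] := pE0 v e; rewrite (betaE _ _ _ sE).
  have -> : @ract k C (restr Z) (th s) c = th (s ** ((c, 0) : trivext E)).
    by rewrite hth.
  apply: betaE.
  rewrite hi sE -ractM trivext_mulE; congr (_ ** _); congr pair.
    by rewrite mul0r.
  by rewrite lact0l add0r.
have b0 := bal0 _ bal.
have thE s v e : i s = v ** ((0, e) : trivext E) -> th s = 0.
  by move/betaE <-; rewrite b0 !lfunE.
have se' : @short_exact k C (restr S) (restr V) M i p.
  split=> //; split=> [s c|v c]; first exact: hi.
  exact: hp.
have hth' : @rhom k C (restr S) (restr Z) th by move=> s c; apply: hth.
have [th' [hth'' th'E]] := ext _ _ _ _ _ se' hth'.
exists th'; split=> // v [c e].
have [s sE] := pE0 v e.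
rewrite restr_split linearD /= -sE -(comp_lfunE th' i) th'E (thE _ _ _ sE).
by rewrite addr0 (restr_split (th' v : Z)) ZE addr0; exact: hth''.
Qed.

Lemma tau_rigid_balanced M : partial_tilting M ->
  tau_rigid (inflate E M) <->
  (forall X, in_Gen M X ->
   forall beta : 'Hom(M, 'Hom(E, X)), balanced beta -> beta = 0).
Proof.
move=> [pdM eM]; rewrite tau_rigid_ext.
split=> [ext X [n [f [hf fT]]] beta bal|bal0 Z].
  apply: (ext_vanish_balanced0 bal); apply: ext.
  exists n, f; split=> // v b; exact: hf v b.1.
move=> [n [f [hf fT]]]; apply: restr_ext_vanish.
- move=> z e; have /limgP[v ->] : z \in limg f by rewrite fT memvf.
  rewrite -hf (_ : v ** _ = 0) ?linear0 //.
  by apply/ffunP => i; rewrite !ffunE; exact: ract0r.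
- apply: ext_vanish_Gen pdM (Ext1_eq0_vanish pdM eM) _.
  by exists n, f; split=> // v c; exact: hf v (c, 0).
- move=> beta; apply: bal0.
  by exists n, f; split=> // v c; exact: hf v (c, 0).
Qed.

End Balanced.

(** * Balanced maps and the inverse translate *)

Section Tensor.
Variables (k : fieldType) (C : falgType k).
Implicit Types M W X Y S : rmodType C.

(** Both sides describe maps out of [Ext^2(D C, M)], which is [Y] on the one
    hand and [M (x) Ext^2(D C, C)] on the other. *)
Lemma balanced_tau_inv (E : bimodType C) M W Y X :
    gldim_le2 C -> is_Ext2_DC E -> is_cosyzygy M W -> is_tau_inv W Y ->
  (forall beta : 'Hom(M, 'Hom(E, X)), balanced beta -> beta = 0) <->
  (forall f : 'Hom(Y, X), rhom f -> f = 0).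
Proof.
move=> gl [P [d [eps [q [res qS qK qL qR]]]]] cW tY.
have [Gam [GS GK GR]] := tau_inv_cosyzygy_ext2 gl cW tY res.
have hd n : rhom (d n) by exact: (res_homd res).
have pP n : projective (P n) by exact: (res_proj res).
have [n [u [chi [chiC cdb]]]] := cocycle_dual_basis gl res.
split=> [bal0 f hf|f0 beta bal].
  have [||U UP] := @subspace_exists k _
      (fun z : 'Hom(P 2%N, regmod C) => cocycle d z).
  - exact: cocycle0.
  - by move=> a z z'; apply: cocycle_lin.
  have [|s sP] := @lfun_section k _ _ q U.
    by move=> e; have [phi [/UP]] := qS e; exists phi.
  have [m _|a m b m' b' mb mb' phi phiC|beta bP] :=
      @lin_choice k M 'Hom(E, X) fullv (fun m b =>
      forall phi, cocycle d phi -> b (q phi) = f (Gam (scal m phi))).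
  - have [|b bE] := @lfun_exists k E X (fun e => f (Gam (scal m (s e)))).
      by move=> a e e'; rewrite linearP scalPr !linearP.
    exists b => phi phiC; rewrite bE; have [/UP sC sE] := sP (q phi).
    apply/eqP; rewrite -subr_eq0 -!linearB /= (_ : Gam _ = 0) ?linear0 //.
    have E1 : scal m (s (q phi)) - scal m phi = scal m (s (q phi) - phi).
      apply/lfunP=> p; rewrite add_lfunE opp_lfunE !scalE add_lfunE opp_lfunE.
      by rewrite linearB.
    have dC : cocycle d (s (q phi) - phi) by apply: cocycleB.
    have [|t [ht tE]] := (qK _ dC).1; first by rewrite linearB /= sE subrr.
    rewrite E1; apply/GK; first exact: cocycle_scal.
    exists (scal m t); split; first exact: rhom_scal.
    by rewrite scal_comp -tE.
  - by rewrite add_lfunE scale_lfunE mb // mb' // scalPl !linearP.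
  have bE m phi (phiC : cocycle d phi) := bP m (memvf m) phi phiC.
  have bal : balanced beta.
    split=> [m c e|m e c]; have [phi [phiC <-]] := qS e.
      by rewrite -qL // !bE //; [rewrite scal_lmul|apply: cocycle_lmul].
    have [h [hh hc he]] := chain_lift c res.
    rewrite -(qR _ _ hh hc he) // !bE //; last exact: cocycle_chain.
    by rewrite -scal_comp (GR _ _ hh hc he) ?hf //; apply: cocycle_scal.
  have b0 := bal0 _ bal.
  apply/lfunP=> y; have [z [zC <-]] := GS y.
  rewrite [RHS]lfunE /= (cdb _ _ zC) !linear_sum big1 // => i _ /=.
  by rewrite -bE // b0 !lfunE.
(* G sends the product of m and a cocycle phi to beta m (q phi). *)
pose G (z : 'Hom(P 2%N, M)) : X := \sum_i beta (z (u i)) (q (chi i)).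
have Glin a z z' : G (a *: z + z') = a *: G z + G z'.
  rewrite /G scaler_sumr -big_split; apply: eq_bigr => i _ /=.
  by rewrite add_lfunE scale_lfunE linearP add_lfunE scale_lfunE.
have G0 : G 0 = 0.
  by rewrite /G big1 // => i _; rewrite lfunE linear0 lfunE.
have Gsum l (z : 'I_l -> 'Hom(P 2%N, M)) : G (\sum_i z i) = \sum_i G (z i).
  elim/big_rec2: _ => // i x y _ <-.
  by have := Glin 1 (z i) y; rewrite !scale1r.
have Gscal m phi : cocycle d phi -> G (scal m phi) = beta m (q phi).
  move=> phiC; rewrite {2}(cdb _ _ phiC) !linear_sum; apply: eq_bigr => i _ /=.
  by rewrite scalE bal.1 -qL //; congr (beta _ (q _)).
have Gcob z : coboundary d z -> G z = 0.
  move=> [z' [hz' ->]]; have [l [v [psi db]]] := proj_dual_basis (pP 1%N).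
  rewrite {1}(dual_basis_scal db hz').
  have -> : ((\sum_i scal (z' (v i)) (psi i)) \o d 1%N)%VF =
      \sum_i scal (z' (v i)) (psi i \o d 1%N)%VF.
    apply/lfunP=> p; rewrite comp_lfunE !sum_lfunE; apply: eq_bigr => i _.
    by rewrite !scalE comp_lfunE.
  rewrite Gsum big1 // => i _.
  have hpsi : rhom (psi i) by apply: db.1.
  have cC := cocycle_coboundary res hpsi.
  rewrite Gscal // (_ : q _ = 0) ?linear0 //.
  by apply/(qK _ cC); exists (psi i).
have [y _|a y x y' x' [z [zC <- ->]] [z' [zC' <- ->]]|f fP] :=
    @lin_choice k Y X fullv (fun y x =>
    exists z, [/\ cocycle d z, Gam z = y & x = G z]).
- by have [z [zC zE]] := GS y; exists (G z), z.
- exists (a *: z + z'); split; [|by rewrite linearP|by rewrite Glin].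
  exact: cocycle_lin.
have fE z : cocycle d z -> f (Gam z) = G z.
  move=> zC; have [z' [z'C zz' ->]] := fP (Gam z) (memvf _).
  have dC : cocycle d (z' - z) by apply: cocycleB.
  have : G (z' - z) = 0.
    by apply/Gcob/(GK _ dC).1; rewrite linearB /= zz' subrr.
  have := Glin (-1) z z'; rewrite !scaleN1r addrC => -> /eqP.
  by rewrite addrC subr_eq0 => /eqP.
have hf : rhom f.
  move=> y c; have [z [zC <-]] := GS y.
  have [h [hh hc he]] := chain_lift c res.
  rewrite -(GR _ _ hh hc he) // !fE //; last exact: cocycle_chain.
  rewrite {1}(cdb _ _ zC).
  have -> : ((\sum_i scal (z (u i)) (chi i)) \o h 2%N)%VF =
      \sum_i scal (z (u i)) (chi i \o h 2%N)%VF.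
    apply/lfunP=> p; rewrite comp_lfunE !sum_lfunE; apply: eq_bigr => i _.
    by rewrite !scalE comp_lfunE.
  rewrite Gsum [G z]/G ract_suml; apply: eq_bigr => i _.
  by rewrite Gscal; [rewrite (qR _ _ hh hc he) // bal.2|apply: cocycle_chain].
have f00 := f0 _ hf.
apply/lfunP=> m; apply/lfunP=> e; have [phi [phiC <-]] := qS e.
rewrite -Gscal // -fE; last exact: cocycle_scal.
by rewrite f00 [LHS]lfunE /= !lfunE.
Qed.

End Tensor.

Theorem theorem1p1 (k : closedFieldType) (C : falgType k) (hC : tilted C)
    (E : bimodType C) (hE : is_Ext2_DC E)
    (M : rmodType C) (hM : partial_tilting M) :
  tau_rigid (inflate E M) <->
  (forall W Y : rmodType C, is_cosyzygy M W -> is_tau_inv W Y ->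
   forall X : rmodType C, in_Gen M X ->
   forall f : 'Hom(Y, X), rhom f -> f = 0).
Proof.
have gl := tilted_gldim_le2 hC; rewrite tau_rigid_balanced //.
split=> [bal0 W Y cW tY X gX|f0 X gX].
  by apply/(balanced_tau_inv X gl hE cW tY); apply: bal0.
have [W cW] := cosyzygy_exists M.
have [N trN] := Tr_exists (dual W).
have tY : is_tau_inv W (opopK N) by exists N; split; last exact: riso_refl.
by apply/(balanced_tau_inv X gl hE cW tY); apply: f0 cW tY _ gX.
Qed.
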